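(* Let $d\ge2$. There is a finite constant $C$ such that for every function $A$ on $\mathbb{R}^d$ with $\nabla A\in L^{d,1}(\mathbb{R}^d)$ and every $\lambda>0$, $$\lambda^d\,\big|\{x\in\mathbb{R}^d:\mathcal{M}(\nabla A)(x)>\lambda\}\big|\le C\,\|\nabla A\|^d_{L^{d,1}(\mathbb{R}^d)},$$ where $$\mathcal{M}(\nabla A)(x)=\sup_{h\in\mathbb{R}^d\setminus\{0\}}\frac{|A(x+h)-A(x)|}{|h|}.$$
   Context: $L^{d,1}(\mathbb{R}^d)$ is the standard Lorentz space, with (up to normalization) $\|g\|_{L^{d,1}}=\int_0^\infty t^{1/d}g^*(t)\frac{dt}{t}$, $g^*$ being the decreasing rearrangement of $g$, and $\|\nabla A\|_{L^{d,1}}=\big\|\big(\sum_{i=1}^d|\partial_iA|^2\big)^{1/2}\big\|_{L^{d,1}}$. $|E|$ denotes Lebesgue measure. A function $A$ with $\nabla A\in L^{d,1}(\mathbb{R}^d)$ is identified with its continuous representative. *)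

(* Defs.v *)
From HB Require Import structures.
From mathcomp Require Import all_boot all_order all_algebra.
From mathcomp Require Import all_classical all_reals all_analysis.
From mathcomp Require Import measurable_realfun complex.

Set Implicit Arguments.
Unset Strict Implicit.
Unset Printing Implicit Defensive.

Import Order.TTheory GRing.Theory Num.Theory.
Import numFieldNormedType.Exports.

Local Open Scope classical_set_scope.
Local Open Scope ring_scope.

Local Notation normc := ComplexField.Normc.normc.

(* Borel sigma-algebra. *)
HB.instance Definition _ (R : realType) (m n : nat) :=
  Measurable.copy 'M[R]_(m, n) (g_sigma_algebraType (@open 'M[R]_(m, n))).

Lemma open_measurable_mx (R : realType) m n (U : set 'M[R]_(m, n)) :
  open U -> measurable U.
Proof. exact: sub_sigma_algebra. Qed.

Definition rV_cons (R : realType) (d : nat)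
    (p : measurableTypeR R * 'rV[R]_d) : 'rV[R]_d.+1 :=
  row_mx (const_mx p.1 : 'M[R]_(1, 1)) p.2.

Lemma rV_cons0 (R : realType) d (p : measurableTypeR R * 'rV[R]_d) :
  rV_cons p 0 0 = p.1.
Proof. by rewrite mxE; case: splitP => j // _; rewrite mxE. Qed.

Lemma rV_consS (R : realType) d (p : measurableTypeR R * 'rV[R]_d) (j : 'I_d) :
  rV_cons p 0 (lift 0 j) = p.2 0 j.
Proof.
rewrite mxE; case: splitP => [k|k /= [jk]]; first by rewrite ord1.
by congr (p.2 0 _); exact/val_inj.
Qed.

Lemma measurable_rV_cons (R : realType) d :
  measurable_fun setT (@rV_cons R d).
Proof.
apply: (@measurability _ _ _ _ _ _ (@open 'rV[R]_d.+1)) => //.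
move=> _ [U oU <-]; rewrite setTI.
pose rad (n : nat) : R := n.+1%:R^-1.
pose box (u : rat * 'rV[rat]_d * nat) : set (measurableTypeR R * 'rV[R]_d) :=
  ball (ratr u.1.1 : R) (rad u.2)
  `*` ball (map_mx ratr u.1.2 : 'rV[R]_d) (rad u.2).
have rad0 n : 0 < rad n by rewrite invr_gt0.
have mbox u : measurable (box u).
  apply: measurableX; first by apply: open_measurable; exact: ball_open.
  by apply: open_measurable_mx; exact: ball_open.
pose F u := if `[< box u `<=` @rV_cons R d @^-1` U >] then box u else set0.
suff -> : @rV_cons R d @^-1` U = \bigcup_u F u.
  by apply: countable_bigcupT_measurable => // u; rewrite /F; case: ifP.
apply/seteqP; split=> [p Up|p [u _]]; last first.
  by rewrite /F; case: ifPn => // /asboolP bU /bU.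
have /nbhs_ballP[e /= e0 eU] : nbhs (rV_cons p) U by exact: open_nbhs_nbhs.
have [n ne] : exists n, rad n + rad n < e.
  have [n hn] : exists n, 0 + rad n < e / 2.
    by apply: ltr_add_invr; rewrite divr_gt0.
  by exists n; rewrite add0r in hn; rewrite [e]splitr ltrD.
have appr (x : R) : exists q : rat, `|ratr q - x| < rad n.
  have [|q] := @rat_in_itvoo R (x - rad n) (x + rad n).
    by rewrite ltrBlDr -addrA ltrDl addr_gt0.
  by rewrite in_itv/= -ltr_distl => ?; exists q.
have [q hq] := appr p.1.
have /choice[v hv] j := appr (p.2 0 j).
have pbox : box (q, \row_j v j, n) p.
  split => /=; first exact: hq.
  by split=> // i j; rewrite (ord1 i) !mxE; exact: hv.
exists (q, \row_j v j, n) => //; rewrite /F ifT//.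
move: pbox => [/= p1 [_ p2]]; apply/asboolP => y [/= y1 [_ y2]].
apply: eU; split => // i j; rewrite (ord1 i).
have tri (a b c : R) : ball a (rad n) b -> ball a (rad n) c -> ball b e c.
  move=> ab ac; apply: (le_ball (ltW ne)).
  by apply: ball_triangle ac; exact: ball_sym.
case: (unliftP 0 j) => [k ->|->]; last by rewrite !rV_cons0; exact: tri p1 y1.
by rewrite !rV_consS; exact: tri (p2 0 k) (y2 0 k).
Qed.

Definition rV_uncons (R : realType) (d : nat) (x : 'rV[R]_d.+1) :
    measurableTypeR R * 'rV[R]_d :=
  (x 0 0, \row_j x 0 (lift 0 j)).

Lemma rV_consK (R : realType) d : cancel (@rV_cons R d) (@rV_uncons R d).
Proof.
move=> p; rewrite /rV_uncons rV_cons0 [RHS]surjective_pairing; congr pair.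
by apply/rowP => j; rewrite mxE rV_consS.
Qed.

Lemma measurable_rV_uncons (R : realType) d :
  measurable_fun setT (@rV_uncons R d).
Proof.
apply/measurable_fun_pairP; split.
  apply: (measurability _ (RGenOInfty.measurableE R)).
  move=> _ [_ [x ->] <-]; rewrite setTI; apply: open_measurable_mx.
  by apply: open_comp (rray_open x) => y _; exact: coord_continuous.
apply: (@measurability _ _ _ _ _ _ (@open 'rV[R]_d)) => //.
move=> _ [U oU <-]; rewrite setTI; apply: open_measurable_mx.
apply: open_comp oU => y _ V /nbhs_ballP[e /= e0 eV].
apply/nbhs_ballP; exists e => //= z [_ yz]; apply: eV; split => // i j.
by rewrite !mxE; exact: yz.
Qed.

Section lebesgue_rV_succ.
Context (R : realType) (d : nat).
Variable mu : {sigma_finite_measure set 'rV[R]_d -> \bar R}.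

Definition lebesgue_rV_succ : set 'rV[R]_d.+1 -> \bar R :=
  pushforward (@lebesgue_measure R \x mu)%E (@rV_cons R d).

Let succ0 : lebesgue_rV_succ set0 = 0%E.
Proof. by rewrite /lebesgue_rV_succ /pushforward preimage_set0 measure0. Qed.

Let mpre A : measurable A -> measurable (@rV_cons R d @^-1` A).
Proof.
by move=> mA; rewrite -[X in measurable X]setTI; exact: measurable_rV_cons.
Qed.

Let succ_ge0 A : (0 <= lebesgue_rV_succ A)%E.
Proof. exact: (measure_ge0 (@lebesgue_measure R \x mu)%E). Qed.

Let succ_sigma_additive : semi_sigma_additive lebesgue_rV_succ.
Proof.
move=> F mF tF mUF; rewrite /lebesgue_rV_succ /pushforward preimage_bigcup.
apply: (measure_semi_sigma_additive (s := (@lebesgue_measure R \x mu)%E)).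
- by move=> n; exact: mpre.
- apply/trivIsetP => /= i j _ _ ij; rewrite -preimage_setI.
  by move/trivIsetP : tF => /(_ _ _ _ _ ij) ->//; rewrite preimage_set0.
- by rewrite -preimage_bigcup; exact: mpre.
Qed.

HB.instance Definition _ := isMeasure.Build _ _ _ lebesgue_rV_succ
  succ0 succ_ge0 succ_sigma_additive.

Let succ_sigma_finite : sigma_finite setT lebesgue_rV_succ.
Proof.
have /sigma_finiteP[F [TF ndF Foo]] := sigma_finiteT (@lebesgue_measure R).
have /sigma_finiteP[G [TG ndG Goo]] := sigma_finiteT mu.
exists (fun n => @rV_uncons R d @^-1` (F n `*` G n)).
  rewrite -preimage_bigcup; apply/esym/seteqP; split=> // x _.
  have [k _ Fk] : (\bigcup_i F i) (rV_uncons x).1 by rewrite -TF.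
  have [l _ Gl] : (\bigcup_i G i) (rV_uncons x).2 by rewrite -TG.
  exists (maxn k l) => //; split.
  - by move: Fk; exact/subsetPset/ndF/leq_maxl.
  - by move: Gl; exact/subsetPset/ndG/leq_maxr.
move=> n; have [mF Fn] := Foo n; have [mG Gn] := Goo n.
have mFG : measurable (F n `*` G n) by exact: measurableX.
split; first by rewrite -[X in measurable X]setTI; exact: measurable_rV_uncons.
rewrite /lebesgue_rV_succ /pushforward -comp_preimage.
rewrite (_ : _ \o _ = id); last by apply/funext => p; exact: rV_consK.
rewrite preimage_id product_measure1E//.
by rewrite lte_mul_pinfty// ge0_fin_numE.
Qed.

HB.instance Definition _ :=
  Measure_isSigmaFinite.Build _ _ _ lebesgue_rV_succ succ_sigma_finite.

End lebesgue_rV_succ.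

(* Lebesgue measure on R^d (on Borel sets) as a d-fold product of the
   one-dimensional one. *)
Fixpoint lebesgue_rV (R : realType) (d : nat) :
    {sigma_finite_measure set 'rV[R]_d -> \bar R} :=
  match d with
  | 0 => \d_(0 : 'rV[R]_0)
  | d'.+1 => lebesgue_rV_succ (lebesgue_rV R d')
  end.

Section lorentz.
Context d (T : measurableType d) (R : realType).
Variable mu : {measure set T -> \bar R}.
Implicit Types f : T -> R.

Definition decreasing_rearrangement f (t : R) : \bar R :=
  ereal_inf [set s%:E | s in
    [set s : R | 0 <= s /\ (mu [set x | (s < `|f x|)%R] <= t%:E)%E]].

(* `L^{p,1}` norm: the integral over `t > 0` of `t^(1/p) f^*(t) dt / t`. *)
Definition lorentz1_norm (p : R) f : \bar R :=
  (\int[lebesgue_measure]_(t in `]0%R, +oo[)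
     ((t `^ p^-1)%:E * decreasing_rearrangement f t * (t^-1)%:E))%E.

End lorentz.

Section weak_gradient.
Context (R : realType) (d : nat).
Local Notation mu := (lebesgue_rV R d).

Definition locally_integrable_rV (f : 'rV[R]_d -> R) : Prop :=
  measurable_fun setT f /\
  forall K, compact K -> (\int[mu]_(x in K) `|f x|%:E < +oo)%E.

Definition iter_partial (s : seq 'I_d) (phi : 'rV[R]_d -> R) : 'rV[R]_d -> R :=
  foldr (fun i f => 'D_('e_i) f) phi s.

Definition smooth (phi : 'rV[R]_d -> R) : Prop :=
  forall s, continuous (iter_partial s phi) /\
    forall i x, derivable (iter_partial s phi) x 'e_i.

Definition test_function (phi : 'rV[R]_d -> R) : Prop :=
  smooth phi /\ compact (closure [set x | phi x != 0]).

Definition is_weak_partial (i : 'I_d) (f g : 'rV[R]_d -> R) : Prop :=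
  [/\ locally_integrable_rV f, locally_integrable_rV g &
    forall phi, test_function phi ->
      \int[mu]_x (f x * 'D_('e_i) phi x) = - \int[mu]_x (g x * phi x)].

(* Pairing a complex-valued function with real test functions splits into real
   and imaginary parts. *)
Definition is_weak_gradient
    (A : 'rV[R]_d -> R[i]) (G : 'I_d -> 'rV[R]_d -> R[i]) : Prop :=
  forall i,
    is_weak_partial i (@complex.Re R \o A) (@complex.Re R \o G i) /\
    is_weak_partial i (@complex.Im R \o A) (@complex.Im R \o G i).

(* `normr` on `'rV[R]_d` is the sup norm. *)
Definition eucl_norm (x : 'rV[R]_d) : R := Num.sqrt (\sum_i x 0 i ^+ 2).

Definition grad_norm (G : 'I_d -> 'rV[R]_d -> R[i]) (x : 'rV[R]_d) : R :=
  Num.sqrt (\sum_i normc (G i x) ^+ 2).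

Definition max_diff_quotient (A : 'rV[R]_d -> R[i]) (x : 'rV[R]_d) : \bar R :=
  ereal_sup [set (normc (A (x + h) - A x) / eucl_norm h)%:E
            | h in [set h : 'rV[R]_d | h != 0]].

End weak_gradient.

(* Main.v *)
(** The increments of [A] are controlled by a chain of averages. For a smooth
    step [H] on the line, [avg u c r] integrates [u] against the tensor product
    of the bumps [H'((t - c_i)/r)/r]. Replacing the parameters [(c, r)] one
    coordinate at a time changes such a bump by a partial derivative of an
    explicit test function, so the weak gradient bounds the difference of two
    averages at comparable scales by [r^(1-d)] times the integral of [|grad A|]
    over a cube. Summing over dyadic scales around [x] and [y] and slicing
    [g = |grad A|] along the levels [s_k = eps 2^k], [E_k = {g > s_k}], gives,
    for [r = |y - x|], [Q] the cube of centre [x] and radius [2r], and any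
    [tau_k > 0],
      [|A y - A x| <= C (eps r + sum_k s_k (tau_k + tau_k^(1-d) |E_k n Q|))];
    this is where [d >= 2] enters. With [a_k = |E_k|^(1/d)],
    [S = sum_k s_k a_k], bounded by twice the Lorentz norm, and
    [tau_k = delta a_k] for a suitable [delta], a point [x] of the bad set has
    a cube with [(lambda r)^d <= C S^(d-1) int_Q F], where
    [F = sum_k s_k a_k^(1-d) 1_(E_k)] has integral [S]. The Vitali covering
    argument applied to [F] concludes. *)

Require Import Defs.
From mathcomp Require Import all_boot all_order all_algebra.
From mathcomp Require Import all_classical all_reals all_analysis.
From mathcomp Require Import measurable_realfun complex.
From mathcomp Require Import ring lra.
Import Order.TTheory GRing.Theory Num.Theory.
Import numFieldNormedType.Exports.
Local Open Scope classical_set_scope.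
Local Open Scope ring_scope.
Set Implicit Arguments.
Unset Strict Implicit.
Unset Printing Implicit Defensive.

(** * A smooth step on the line *)

Section smooth_on_line.
Variable R : realType.
Implicit Types f g : R -> R.

(** Each derivative is carried as a witness function, so closure under sums, products, inverses and
    affine substitutions follows by induction on the order, with no formula for higher
    derivatives. *)
Fixpoint diffn n f : Prop :=
  if n is m.+1 then exists2 g : R -> R, (forall x : R, is_derive x 1 f (g x)) & diffn m g
  else True.

Lemma diffnW n f : diffn n.+1 f -> diffn n f.
Proof.
elim: n f => [//|n ih] f [g fg /ih dg]; by exists g.
Qed.

Lemma diffn_cst n (c : R) : diffn n (cst c).
Proof.
elim: n c => [//|n ih] c; exists (cst 0) => //.
by move=> x; exact: is_derive_cst.
Qed.

Lemma diffnD n f g : diffn n f -> diffn n g -> diffn n (f \+ g).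
Proof.
elim: n f g => [//|n ih] f g [f' ff' df] [g' gg' dg].
exists (f' \+ g') => [x|]; last exact: ih.
exact: is_deriveD.
Qed.

Lemma diffnM n f g : diffn n f -> diffn n g -> diffn n (f \* g).
Proof.
elim: n f g => [//|n ih] f g df dg.
have [f' ff' df'] := df; have [g' gg' dg'] := dg.
exists ((f \* g') \+ (g \* f')) => [x|]; first exact: is_deriveM.
by apply: diffnD; apply: ih => //; exact: diffnW.
Qed.

Lemma diffnV n f : (forall x, f x != 0) -> diffn n f -> diffn n (fun x => (f x)^-1).
Proof.
move=> f0; elim: n => [//|n ih] df; have [f' ff' df'] := df.
exists ((cst (-1) \* ((fun x => (f x)^-1) \* (fun x => (f x)^-1))) \* f') => [x|].
  by apply: is_derive_eq (is_deriveV (f0 x) (ff' x)) _;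
    rewrite /= /GRing.scale/= -exprVn expr2; ring.
apply: diffnM => //; apply: diffnM; first exact: diffn_cst.
by apply: diffnM; apply: ih; exact: diffnW.
Qed.

Lemma is_derive_affine (a b x : R) : is_derive x 1 (fun t => a * (t - b)) a.
Proof.
apply: is_derive_eq.
by rewrite /GRing.scale/= subr0 mulr1.
Qed.

Lemma diffn_affine n f (a b : R) : diffn n f -> diffn n (fun t => f (a * (t - b))).
Proof.
elim: n f => [//|n ih] f [f' ff' df].
exists ((fun t => f' (a * (t - b))) \* cst a) => [x|].
  by apply: (@is_derive1_comp _ f (fun t => a * (t - b))); exact: is_derive_affine.
by apply: diffnM; [exact: ih|exact: diffn_cst].
Qed.

Definition smooth1 f := forall n, diffn n f.

Lemma smooth1_is_derive f (x : R) : smooth1 f -> is_derive x 1 f (f^`()%classic x).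
Proof.
move=> /(_ 1%N) [g fg _]; apply: is_derive_eq (fg x) _.
by rewrite derive1E; apply/esym/derive_val.
Qed.

Lemma smooth1_derive f : smooth1 f -> smooth1 f^`()%classic.
Proof.
move=> sf n; have [g fg dg] := sf n.+1.
rewrite (_ : f^`()%classic = g)//; apply/funext => x.
by rewrite derive1E; apply: derive_val.
Qed.

Lemma smooth1_continuous f : smooth1 f -> continuous f.
Proof.
move=> sf x; apply: differentiable_continuous; apply/derivable1_diffP.
by have := smooth1_is_derive x sf; case.
Qed.

(** The bound forces [f x = 0] and keeps the difference quotient below [C * |h|]. It settles
    [flat k] at the origin, where its two defining formulas meet. *)
Lemma is_derive0_sqr f (C x : R) : (forall t : R, `|f (t + x)| <= C * t ^+ 2) ->
  is_derive x 1 f 0.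
Proof.
move=> fC; have fx : f x = 0.
  by apply/eqP; rewrite -normr_le0; have := fC 0; rewrite add0r expr0n/= mulr0.
have C0 : 0 <= C by have := fC 1; rewrite expr1n mulr1; apply: le_trans.
suff cv : h^-1 *: (f (h *: 1 + x) - f x) @[h --> 0^'] --> (0 : R).
  by apply: DeriveDef; [apply/cvg_ex; exists 0; exact: cv|exact/cvg_lim].
apply/cvgr0Pnorm_le => e e0; near=> h.
have h0 : h != 0 by near: h; exact: nbhs_dnbhs_neq.
rewrite fx subr0 /GRing.scale/= mulr1 normrM normfV.
rewrite ler_pdivrMl ?normr_gt0//; apply: le_trans (fC h) _.
have -> : C * h ^+ 2 = `|h| * (C * `|h|).
  by rewrite [RHS]mulrCA -expr2 real_normK ?num_real.
rewrite ler_wpM2l//.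
have : `|h| <= e / (C + 1).
  near: h; apply: dnbhs0_le; rewrite divr_gt0// ltr_wpDl//.
rewrite ler_pdivlMr ?ltr_wpDl//; apply: le_trans.
by rewrite mulrC ler_wpM2l// lerDl.
Unshelve. all: by end_near. Qed.

(* The functions [t^-k exp(-1/t)] extended by zero are stable under
   differentiation, which gives smoothness of all of them at once. *)
Definition flat (k : nat) (t : R) : R :=
  if 0 < t then t^-1 ^+ k * expR (- t^-1) else 0.

(** For s = 1/t > 0 the term of order k+2 of the exponential series gives exp(s) >= s^(k+2)/(k+2)!,
    hence s^k exp(-s) <= (k+2)! t^2. *)
Lemma flat_bound k t : `|flat k t| <= k.+2`!%:R * t ^+ 2.
Proof.
rewrite /flat; case: ifPn => t0; last by rewrite normr0 mulr_ge0 ?sqr_ge0.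
have s0 : 0 < t^-1 by rewrite invr_gt0.
rewrite ger0_norm; last by rewrite mulr_ge0 ?expR_ge0// exprn_ge0// ltW.
have := @expR_ge1Dxn R t^-1 k.+1 (ltW s0).
rewrite expRN ler_pdivrMr ?expR_gt0// => h.
have -> : t^-1 ^+ k = t^-1 ^+ k.+2 * t ^+ 2.
  by rewrite !exprS; field; rewrite gt_eqF.
rewrite [leRHS]mulrAC ler_wpM2r ?sqr_ge0//.
have f0 : 0 < k.+2`!%:R :> R by rewrite ltr0n fact_gt0.
rewrite mulrC -ler_pdivrMr//; apply: le_trans h; by rewrite lerDr.
Qed.

Lemma flat_is_derive k (t : R) :
  is_derive t 1 (flat k) (flat k.+2 t - k%:R * flat k.+1 t).
Proof.
have [t0|t0|->] := ltgtP t 0.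
- rewrite {2 3}/flat ltNge ltW//= mulr0 subr0.
  apply: (@near_eq_is_derive _ _ _ (cst 0)).
  near=> s; rewrite /flat ltNge ltW//=; near: s; exact: lt_nbhsl.
- rewrite {2 3}/flat t0.
  have tn0 : t != 0 by rewrite gt_eqF.
  have dV : is_derive t 1 (fun s : R => s^-1) (- t ^- 2).
    by apply: is_derive_eq (@is_deriveV _ id t 1 1 tn0 _) _;
      rewrite /GRing.scale/= mulr1.
  have dE : is_derive t 1 (fun s : R => expR (- s^-1)) (expR (- t^-1) * t ^- 2).
    have dN : is_derive t 1 (fun s : R => - s^-1) (t ^- 2).
      by apply: is_derive_eq (is_deriveN dV) _; rewrite opprK.
    exact: (@is_derive1_comp _ expR (fun s : R => - s^-1)).
  have d : is_derive t 1 (fun s : R => s^-1 ^+ k * expR (- s^-1))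
      (t^-1 ^+ k.+2 * expR (- t^-1) - k%:R * (t^-1 ^+ k.+1 * expR (- t^-1))).
    rewrite (_ : (fun s => _) = (fun s : R => s^-1) ^+ k * (fun s => expR (- s^-1))).
      2: by apply/funext => s; rewrite /GRing.mul/= exprfctE.
    apply: is_derive_eq (is_deriveM (is_deriveX k dV) dE) _.
    rewrite /GRing.scale/= exprfctE/= -!exprVn.
    by case: k => [|k]; rewrite /= !exprS; ring.
  apply: near_eq_is_derive d; near=> s; rewrite /flat ifT//.
  by near: s; exact: lt_nbhsr.
- rewrite {2 3}/flat ltxx mulr0 subr0.
  by apply: (@is_derive0_sqr _ k.+2`!%:R) => s; rewrite addr0 flat_bound.
Unshelve. all: by end_near. Qed.

Lemma flat_smooth k : smooth1 (flat k).
Proof.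
move=> n; elim: n k => [//|n ih] k.
exists (flat k.+2 \+ (cst (- k%:R) \* flat k.+1)) => [x|].
  by apply: is_derive_eq (flat_is_derive k x) _; rewrite /= mulNr.
by apply: diffnD => //; apply: diffnM => //; exact: diffn_cst.
Qed.

(** The quotient [flat 0 t / (flat 0 t + flat 0 (1 - t))] works: its denominator is positive because
    [t] and [1 - t] are never both nonpositive. *)
Lemma smooth_step : exists2 H : R -> R, smooth1 H &
  forall t, [/\ 0 <= H t <= 1, t <= 0 -> H t = 0 & 1 <= t -> H t = 1].
Proof.
have f0 t : 0 <= flat 0 t.
  by rewrite /flat; case: ifP => // _; rewrite mul1r expR_ge0.
have fp t : 0 < t -> 0 < flat 0 t by rewrite /flat => ->; rewrite mul1r expR_gt0.
have fn t : t <= 0 -> flat 0 t = 0 by rewrite /flat ltNge => ->.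
pose D t := flat 0 t + flat 0 ((-1) * (t - 1)).
have Dp t : 0 < D t.
  have [t0|t0] := ltP 0 t; first by rewrite ltr_pwDl// fp.
  by rewrite ltr_wpDl// fp//; lra.
exists (fun t => flat 0 t * (D t)^-1).
  move=> n; apply: diffnM; first exact: flat_smooth.
  apply: diffnV => [x|]; first by rewrite gt_eqF.
  by apply: diffnD; [|apply: diffn_affine]; exact: flat_smooth.
move=> t; split => [|t0|t1].
- rewrite divr_ge0 ?(ltW (Dp t))//= ler_pdivrMr// mul1r /D lerDl//.
- by rewrite fn// mul0r.
- rewrite /D (fn (_ * _)) ?addr0 ?divff//; last lra.
  by rewrite gt_eqF// fp// (lt_le_trans _ t1).
Qed.

Lemma smooth_locally_cst f (c t : R) : (\near t, cst c t = f t) -> f^`()%classic t = 0.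
Proof.
move=> ct; rewrite derive1E -(near_eq_derive _ ct).
exact: (@derive_val _ _ _ t 1 (cst c) 0).
Qed.

(** A bump is handled through its primitive: the derivative of a step lives on [[a, b]] and has
    integral 1, while the difference of two steps is a compactly supported primitive of the
    difference of their bumps. *)
Definition step (a b : R) f :=
  [/\ smooth1 f, forall t, t <= a -> f t = 0 & forall t, b <= t -> f t = 1].

Lemma step_deriv0 a b f t : step a b f -> ~ (a <= t <= b) -> f^`()%classic t = 0.
Proof.
move=> [sf f0 f1] /negP; rewrite negb_and -!ltNge => /orP[ta|bt].
  apply: (@smooth_locally_cst _ 0); near=> s; rewrite f0//.
  by rewrite ltW//; near: s; exact: lt_nbhsl.
apply: (@smooth_locally_cst _ 1); near=> s; rewrite f1//.
by rewrite ltW//; near: s; exact: lt_nbhsr.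
Unshelve. all: by end_near. Qed.

Lemma smooth_step_bounded : exists H : R -> R, exists2 M : R, 1 <= M &
  [/\ step 0 1 H, forall t, `|H t| <= 1 & forall t, `|H^`()%classic t| <= M].
Proof.
have [H sH hH] := smooth_step.
have stepH : step 0 1 H by split => // t; have [] := hH t.
have [|c _ cM] := @EVT_max R (fun t => `|H^`()%classic t|) 0 1 ler01.
  apply: continuous_subspaceT => x.
  by apply: continuous_comp; [exact/smooth1_continuous/smooth1_derive|
    exact: norm_continuous].
(* The derivative vanishes off [[0, 1]], so the maximum of its modulus there bounds it everywhere;
   adding 1 secures [1 <= M]. *)
exists H, (`|H^`()%classic c| + 1); first by rewrite lerDr.
split => // t; first by have [/andP[? ?] _ _] := hH t; rewrite ger0_norm.
have [t01|/negP t01] := boolP (0 <= t <= 1).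
  by rewrite (le_trans (cM t _)) ?lerDl// in_itv/=.
by rewrite (step_deriv0 stepH)// normr0 addr_ge0.
Qed.

Lemma derive1_affine f (a b t : R) : smooth1 f ->
  (fun t => f (a * (t - b)))^`()%classic t = a * f^`()%classic (a * (t - b)).
Proof.
move=> sf; rewrite derive1E mulrC; apply: derive_val.
by apply: (@is_derive1_comp _ f (fun t => a * (t - b)));
  [exact: smooth1_is_derive|exact: is_derive_affine].
Qed.

Lemma scaled_step H (M c r : R) : 0 < r -> step 0 1 H ->
  (forall t, `|H t| <= 1) -> (forall t, `|H^`()%classic t| <= M) ->
  let F t := H (r^-1 * (t - c)) in
  [/\ step c (c + r) F, forall t, `|F t| <= 1 & forall t, `|F^`()%classic t| <= M / r].
Proof.
move=> r0 [sH H0 H1] Hb Mb F; split => [|t|t]; last 2 first.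
- exact: Hb.
- rewrite derive1_affine// normrM ger0_norm ?invr_ge0 ?(ltW r0)// mulrC.
  by rewrite ler_wpM2r// invr_ge0 ltW.
split => [n|t tc|t ct]; first exact: diffn_affine.
- by apply: H0; rewrite pmulr_rle0 ?invr_gt0// subr_le0.
- by apply: H1; rewrite mulrC ler_pdivlMr// mul1r lerBrDl.
Qed.

Lemma step_integral a b f : a < b -> step a b f ->
  (\int[lebesgue_measure]_x (f^`()%classic x)%:E = 1)%E.
Proof.
move=> ab sf; have [smf f0 f1] := sf.
have cf' : continuous f^`()%classic by exact/smooth1_continuous/smooth1_derive.
rewrite (_ : \int[_]_x _ =
    \int[lebesgue_measure]_(x in `[a, b]) (f^`()%classic x)%:E)%E; last first.
  rewrite [RHS]integral_mkcond; apply: eq_integral => x _.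
  rewrite patchE; case: ifPn => //; rewrite notin_setE/= in_itv/= => abx.
  by rewrite (step_deriv0 sf).
rewrite (@continuous_FTC2 _ _ f)//; last 2 first.
- exact: continuous_subspaceT.
- have cf := smooth1_continuous smf; split.
  + by move=> x _; have := smooth1_is_derive x smf; case.
  + exact/cvg_at_right_filter/cf.
  + exact/cvg_at_left_filter/cf.
by rewrite (f0 a)// (f1 b)// sube0.
Qed.

End smooth_on_line.

(** * Cubes and tensor products *)

Section cubes.
Variables (R : realType) (d : nat).
Implicit Types (x y z : 'rV[R]_d) (r : R).

(** The closed ball of the sup norm, written by coordinates so that [rV_cons] pulls it back to an
    interval times a cube of one dimension less. *)
Definition cube x r : set 'rV[R]_d := [set z | forall i, `|z 0 i - x 0 i| <= r].

Lemma compact_cube x r : compact (cube x r).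
Proof.
have -> : cube x r = [set v | forall i, `[x 0 i - r, x 0 i + r]%classic (v ord0 i)].
  by apply/seteqP; split=> z zi i; have := zi i; rewrite /= in_itv/= ler_distl.
exact: (@rV_compact R d (fun i => `[x 0 i - r, x 0 i + r]%classic)
  (fun i => @segment_compact R _ _)).
Qed.

Lemma closed_cube x r : closed (cube x r).
Proof.
apply: compact_closed; [exact: norm_hausdorff|exact: compact_cube].
Qed.

Lemma measurable_cube x r : measurable (cube x r).
Proof.
rewrite -[X in measurable X]setCK; apply: measurableC.
by apply: open_measurable_mx; rewrite openC; exact: closed_cube.
Qed.

Lemma cubeP x r z : 0 <= r -> cube x r z <-> `|z - x| <= r.
Proof.
move=> r0; rewrite /Num.norm/= mx_normrE; split => [h|/bigmax_leP[_ h] i].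
  by apply/bigmax_leP; split=> // -[i j] _ /=; rewrite (ord1 i) !mxE; exact: h.
by have := h (0, i) isT; rewrite !mxE.
Qed.

Lemma cube_sub x y r s : 0 <= r -> `|x - y| + r <= s -> cube x r `<=` cube y s.
Proof.
move=> r0 xyrs z /(cubeP _ _ r0) zx; apply/cubeP.
  by rewrite (le_trans _ xyrs)// addr_ge0.
rewrite -(subrK x z) -addrA (le_trans (ler_normD _ _))// (le_trans _ xyrs)//.
by rewrite [leLHS]addrC lerD2l.
Qed.

End cubes.

Section tensor.
Variables (R : realType) (d : nat).
Implicit Types (f g : 'I_d -> R -> R) (z : 'rV[R]_d).

Definition tensor f z : R := \prod_i f i (z 0 i).

(** Differentiating a tensor product in direction [i] changes only its factor [i], so partial
    derivatives of all orders remain tensor products. *)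
Definition upd f (i : 'I_d) (h : R -> R) : 'I_d -> R -> R :=
  fun j => if j == i then h else f j.

Lemma tensor_upd f i h z :
  tensor (upd f i h) z = h (z 0 i) * \prod_(j | j != i) f j (z 0 j).
Proof.
rewrite /tensor (bigD1 i)//= /upd eqxx; congr (_ * _).
by apply: eq_bigr => j /negbTE ->.
Qed.

Lemma updE f i : upd f i (f i) = f.
Proof. by apply/funext => j; rewrite /upd; case: eqP => // ->. Qed.

Lemma tensorB_upd f i (h k : R -> R) z :
  tensor (upd f i (h \- k)) z = tensor (upd f i h) z - tensor (upd f i k) z.
Proof. by rewrite !tensor_upd mulrBl. Qed.

(** Along a line in direction ['e_i] the other factors are constant, so the difference quotient is
    that of [h] times this constant. *)
Lemma tensor_is_derive f i (h h' : R -> R) z : (forall t : R, is_derive t 1 h (h' t)) ->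
  is_derive z 'e_i (tensor (upd f i h)) (tensor (upd f i h') z).
Proof.
move=> hh'; set c := \prod_(j | j != i) f j (z 0 j).
have E t : tensor (upd f i h) (t *: 'e_i + z) = h (t *: 1 + z 0 i) * c.
  rewrite tensor_upd !mxE !eqxx/= /c; congr (_ * _).
  by apply: eq_bigr => j /negbTE ji; rewrite !mxE ji andbF mulr0 add0r.
suff cv : t^-1 *: (tensor (upd f i h) (t *: 'e_i + z) - tensor (upd f i h) z)
    @[t --> 0^'] --> tensor (upd f i h') z.
  apply: DeriveDef; [apply/cvg_ex; exists (tensor (upd f i h') z); exact: cv|].
  by apply/cvg_lim => //; exact: norm_hausdorff.
have -> : (fun t => t^-1 *: (tensor (upd f i h) (t *: 'e_i + z) - tensor (upd f i h) z))
    = (fun t => t^-1 *: (h (t *: 1 + z 0 i) - h (z 0 i)) * c).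
  apply/funext => t; rewrite E tensor_upd -/c -mulrBl /GRing.scale/=.
  by rewrite mulrA.
rewrite tensor_upd -/c; apply: cvgMr_tmp; have [dh <-] := hh' (z 0 i).
exact: dh.
Qed.

Lemma tensor_continuous f : (forall i, continuous (f i)) -> continuous (tensor f).
Proof.
move=> cf; apply: continuous_big => [|i _ z].
  by move=> p; apply: mul_continuous.
by apply: continuous_comp; [exact: coord_continuous|exact: cf].
Qed.

Lemma tensor_derive f i z : smooth1 (f i) ->
  'D_('e_i) (tensor f) z = tensor (upd f i (f i)^`()%classic) z.
Proof.
move=> sf.
have := @tensor_is_derive f i (f i) (f i)^`()%classic z
  (fun t => smooth1_is_derive t sf).
by rewrite updE => df; exact: derive_val.
Qed.

Lemma iter_partial_tensor (s : seq 'I_d) f : (forall i, smooth1 (f i)) ->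
  exists2 g, (forall i, smooth1 (g i)) & iter_partial s (tensor f) = tensor g.
Proof.
move=> sf; elim: s => [|i s [g sg E]]; first by exists f.
exists (upd g i (g i)^`()%classic); last first.
  by rewrite /= E; apply/funext => z; rewrite tensor_derive.
move=> j; rewrite /upd; case: ifP => // _; exact: smooth1_derive.
Qed.

Lemma tensor_smooth f : (forall i, smooth1 (f i)) -> smooth (tensor f).
Proof.
move=> sf s; have [g sg ->] := iter_partial_tensor s sf; split.
  by apply: tensor_continuous => i; exact: smooth1_continuous.
move=> i z; have := @tensor_is_derive g i (g i) (g i)^`()%classic z
  (fun t => smooth1_is_derive t (sg i)).
by rewrite updE; case.
Qed.

Lemma tensor_test_function f x r : (forall i, smooth1 (f i)) ->
  (forall z, ~ cube x r z -> tensor f z = 0) -> test_function (tensor f).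
Proof.
move=> sf f0; split; first exact: tensor_smooth.
have sub : closure [set z | tensor f z != 0] `<=` cube x r.
  rewrite [X in _ `<=` X](closure_id _).1; last exact: closed_cube.
  apply: closure_subset => z /= /eqP tz; apply: contrapT => /f0; exact: tz.
apply: subclosed_compact sub; [exact: closed_closure|exact: compact_cube].
Qed.

End tensor.

(** * Lebesgue measure of cubes, integrals of bumps *)

Section lebesgue_cube.
Variable R : realType.
Local Notation leb := (@lebesgue_measure R).

Lemma continuous_measurable_rV d (f : 'rV[R]_d -> R) :
  continuous f -> measurable_fun setT f.
Proof.
move=> cf; apply: (measurability _ (RGenOInfty.measurableE R)).
move=> _ [_ [x ->] <-]; rewrite setTI; apply: open_measurable_mx.
by apply: open_comp (rray_open x) => y _; exact: cf.
Qed.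

Lemma lebesgue_rVS d (A : set 'rV[R]_d.+1) :
  lebesgue_rV R d.+1 A = (leb \x lebesgue_rV R d)%E (@rV_cons R d @^-1` A).
Proof. by []. Qed.

(** Induction on the dimension through the product structure of the measure; in dimension 0 the
    measure is a Dirac mass, bounded by the empty power 1. *)
Lemma lebesgue_cube_le d (x : 'rV[R]_d) (r : R) : 0 <= r ->
  (lebesgue_rV R d (cube x r) <= ((r *+ 2) ^+ d)%:E)%E.
Proof.
move=> r0; elim: d x => [|d ih] x.
  by rewrite expr0 /= diracE; case: (_ \in _); rewrite lee_fin.
rewrite lebesgue_rVS.
have -> : @rV_cons R d @^-1` cube x r =
    `[x 0 0 - r, x 0 0 + r] `*` cube (\row_j x 0 (lift 0 j)) r.
  apply/seteqP; split => [p h|p [h1 h2] i].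
    split; first by have := h 0; rewrite rV_cons0 ler_distl/= in_itv.
    by move=> j; have := h (lift 0 j); rewrite rV_consS mxE.
  case: (unliftP 0 i) => [j ->|->]; first by rewrite rV_consS; have := h2 j; rewrite mxE.
  by rewrite rV_cons0 ler_distl; move: h1; rewrite /= in_itv.
rewrite product_measure1E//; last exact: measurable_cube.
rewrite exprS EFinM lee_pmul//.
have /= E := @lebesgue_measure_itv R `[x 0 0 - r, x 0 0 + r].
rewrite [X in (X <= _)%E]E lte_fin; case: ifPn => _; last by rewrite lee_fin mulrn_wge0.
by rewrite lee_fin mulr2n; lra.
Qed.

Section bounded_bump.
Variables (d : nat) (u psi : 'rV[R]_d -> R) (x : 'rV[R]_d) (r M : R).
Local Notation mu := (lebesgue_rV R d).
Hypothesis mu_ : measurable_fun setT u.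
Hypothesis mpsi : measurable_fun setT psi.
Hypothesis psiM : forall z, `|psi z| <= M.
Hypothesis psi0 : forall z, ~ cube x r z -> psi z = 0.

Lemma le_integral_mul_cube :
  (\int[mu]_z `|u z * psi z|%:E <= M%:E * \int[mu]_(z in cube x r) `|u z|%:E)%E.
Proof.
have M0 : 0 <= M by apply: le_trans (psiM x).
have mE (D : set 'rV[R]_d) (f : 'rV[R]_d -> R) : measurable_fun setT f ->
    measurable_fun D (fun z => `|f z|%:E).
  move=> mf; apply: measurable_funTS; apply/measurable_EFinP.
  exact: measurableT_comp.
rewrite (_ : \int[_]_z _ = \int[mu]_(z in cube x r) `|u z * psi z|%:E)%E; last first.
  rewrite [RHS]integral_mkcond; apply: eq_integral => z _.
  rewrite patchE; case: ifPn => //; rewrite notin_setE => /psi0 ->.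
  by rewrite mulr0 normr0.
rewrite -ge0_integralZl_EFin//; first last.
- exact: mE.
- exact: measurable_cube.
apply: ge0_le_integral => //.
- exact: measurable_cube.
- by apply: mE; exact: measurable_funM.
- by apply: emeasurable_funM => //; exact: mE.
- by move=> z _; rewrite -EFinM lee_fin normrM mulrC ler_wpM2r.
Qed.

Lemma integrable_mul_cube : (\int[mu]_(z in cube x r) `|u z|%:E < +oo)%E ->
  mu.-integrable setT (fun z => (u z * psi z)%:E).
Proof.
move=> uoo; apply/integrableP; split.
  by apply/measurable_EFinP; exact: measurable_funM.
apply: le_lt_trans le_integral_mul_cube _.
by rewrite lte_mul_pinfty// ?lee_fin// (le_trans _ (psiM x)).
Qed.

Lemma le_Rintegral_mul_cube :
  (`|\int[mu]_z (u z * psi z)|%:E <= M%:E * \int[mu]_(z in cube x r) `|u z|%:E)%E.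
Proof.
apply: le_trans le_integral_mul_cube.
have mf : measurable_fun setT (fun z => (u z * psi z)%:E).
  by apply/measurable_EFinP; exact: measurable_funM.
apply: le_trans (le_abse_integral mu measurableT mf).
(* [Rintegral] is the finite part of the integral, with value 0 when that is infinite; in each case
   its modulus is at most that of the extended integral. *)
by rewrite /Rintegral; case: (integral _ _ _) => [s||] //=; rewrite leey.
Qed.

End bounded_bump.

Lemma tensor_cons d (f : 'I_d.+1 -> R -> R) p :
  tensor f (rV_cons p) = f 0 p.1 * tensor (fun j => f (lift 0 j)) p.2.
Proof.
rewrite /tensor big_ord_recl rV_cons0; congr (_ * _).
by apply: eq_bigr => j _; rewrite rV_consS.
Qed.

Lemma tensor_bound d (f : 'I_d -> R -> R) (B : 'I_d -> R) (z : 'rV[R]_d) :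
  (forall i t, `|f i t| <= B i) -> `|tensor f z| <= \prod_i B i.
Proof.
move=> fB; rewrite /tensor normr_prod; apply: ler_prod => i _.
by rewrite normr_ge0 fB.
Qed.

Lemma tensor_eq0 d (f : 'I_d -> R -> R) (z : 'rV[R]_d) i : f i (z 0 i) = 0 -> tensor f z = 0.
Proof. by move=> f0; rewrite /tensor (bigD1 i)//= f0 mul0r. Qed.

Lemma step_tensor_eq0 d (F : 'I_d -> R -> R) (c : 'rV[R]_d) r z :
  (forall i, step (c 0 i) (c 0 i + r) (F i)) -> ~ cube c r z ->
  tensor (fun i => (F i)^`()%classic) z = 0.
Proof.
move=> sF /existsNP[i zi]; apply: (tensor_eq0 (i := i)).
apply: (step_deriv0 (sF i)) => /andP[cz zc]; apply: zi.
by rewrite ger0_norm ?subr_ge0// lerBlDl.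
Qed.

Lemma step_tensor_continuous d (F : 'I_d -> R -> R) :
  (forall i, smooth1 (F i)) -> continuous (tensor (fun i => (F i)^`()%classic)).
Proof.
by move=> sF; apply: tensor_continuous => i; exact/smooth1_continuous/smooth1_derive.
Qed.

Lemma step_tensor_integrable d (F : 'I_d -> R -> R) (c : 'rV[R]_d) r B : 0 <= r ->
  (forall i, step (c 0 i) (c 0 i + r) (F i)) ->
  (forall i t, `|(F i)^`()%classic t| <= B) ->
  (lebesgue_rV R d).-integrable setT (EFin \o tensor (fun i => (F i)^`()%classic)).
Proof.
move=> r0 sF FB.
have mF : measurable_fun setT (tensor (fun i => (F i)^`()%classic)).
  apply: continuous_measurable_rV; apply: step_tensor_continuous => i.
  by have [] := sF i.
rewrite (_ : _ \o _ = fun z => (cst 1 z * tensor (fun i => (F i)^`()%classic) z)%:E); last first.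
  by apply/funext => z /=; rewrite mul1r.
apply: (@integrable_mul_cube _ _ _ c r (\prod_(i < d) B)) => //.
- by move=> z; apply: tensor_bound.
- by move=> z; apply: step_tensor_eq0 sF.
- under eq_integral do rewrite /= normr1.
  rewrite integral_cst ?mul1e; last exact: measurable_cube.
  by rewrite (le_lt_trans (lebesgue_cube_le _ r0))// ltry.
Qed.

(** Induction on the dimension by Fubini: after pulling back along [rV_cons], the inner integral is
    1 by induction and the outer one is the integral of the derivative of a step. *)
Lemma integral_step_tensor d (F : 'I_d -> R -> R) (c : 'rV[R]_d) r B : 0 < r ->
  (forall i, step (c 0 i) (c 0 i + r) (F i)) ->
  (forall i t, `|(F i)^`()%classic t| <= B) ->
  (\int[lebesgue_rV R d]_z (tensor (fun i => (F i)^`()%classic) z)%:E = 1)%E.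
Proof.
move=> r0; elim: d F c => [|d ih] F c sF FB.
  rewrite integral_dirac//=; last first.
    have := step_tensor_integrable (ltW r0) sF FB.
    by case/integrableP.
  by rewrite diracT mul1e /tensor big_ord0.
have := step_tensor_integrable (ltW r0) sF FB.
set phi := tensor _ => iphi; have [mphi phioo] := integrableP _ _ _ iphi.
pose phi' := tensor (fun j => (F (lift 0 j))^`()%classic).
pose c' : 'rV[R]_d := \row_j c 0 (lift 0 j).
have sF' j : step (c' 0 j) (c' 0 j + r) (F (lift 0 j)) by rewrite mxE.
have iphi' := step_tensor_integrable (ltW r0) sF' (fun j => FB (lift 0 j)).
have phiE p : phi (rV_cons p) = (F 0)^`()%classic p.1 * phi' p.2.
  by rewrite /phi tensor_cons.
have icons : (leb \x lebesgue_rV R d)%E.-integrable setT (EFin \o phi \o @rV_cons R d).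
  apply/integrableP; split.
    apply: measurableT_comp; first exact: mphi.
    exact: measurable_rV_cons.
  have mabs : measurable_fun setT (fun z => `|(phi z)%:E|%E).
    exact: measurableT_comp.
  have E := @ge0_integral_pushforward _ _ _ _ R (@rV_cons R d)
    (@measurable_rV_cons R d) (leb \x lebesgue_rV R d)%E setT
    (fun z => `|(phi z)%:E|%E) measurableT mabs (fun z _ => abse_ge0 _).
  by rewrite preimage_setT in E; rewrite -E.
have -> : (\int[lebesgue_rV R d.+1]_z (phi z)%:E =
    \int[(leb \x lebesgue_rV R d)%E]_p (phi (rV_cons p))%:E)%E.
  have E := @integral_pushforward _ _ _ _ R (@rV_cons R d)
    (@measurable_rV_cons R d) (leb \x lebesgue_rV R d)%E setT (EFin \o phi) mphi.
  by rewrite preimage_setT in E; rewrite -E.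
rewrite -integral12_prod_meas1//.
rewrite -[RHS](step_integral _ (sF 0)); last by rewrite ltrDl.
apply: eq_integral => t _; rewrite /fubini_F.
under eq_integral do rewrite phiE EFinM.
have /= -> := integralZl measurableT iphi' ((F 0)^`()%classic t).
by rewrite (ih _ _ sF' (fun j => FB (lift 0 j))) mule1.
Qed.

End lebesgue_cube.

(** * Changing the bump *)

Section oscillation.
Variables (R : realType) (d : nat).
Local Notation mu := (lebesgue_rV R d).
Implicit Types (F : 'I_d -> R -> R) (c z : 'rV[R]_d).

Definition bumped F : 'rV[R]_d -> R := tensor (fun i => (F i)^`()%classic).

(** Here [c] is a corner and not the centre: [bumped F] is supported in the cube with corner [c] and
    side [r], which lies in [cube c r]. *)
Record steps c (r B : R) F : Prop := Steps {
  steps_step : forall i, step (c 0 i) (c 0 i + r) (F i);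
  steps_le1 : forall i t, `|F i t| <= 1;
  steps_derive : forall i t, `|(F i)^`()%classic t| <= B }.

Lemma locally_integrable_cube (u : 'rV[R]_d -> R) c (r : R) : locally_integrable_rV u ->
  (\int[mu]_(z in cube c r) `|u z|%:E < +oo)%E.
Proof. by move=> [_]; apply; exact: compact_cube. Qed.

Lemma cube_coord c c1 (r r1 : R) i (t : R) : `|c1 - c| + r1 <= r -> 0 <= r1 ->
  c1 0 i <= t <= c1 0 i + r1 -> `|t - c 0 i| <= r.
Proof.
move=> cr r10 /andP[ct tc].
have : cube c1 r1 `<=` cube c r by exact: cube_sub.
(* The inclusion of cubes is tested at [c1] with coordinate [i] replaced by [t]. *)
move=> /(_ (\row_j if j == i then t else c1 0 j)); rewrite /cube/=.
move=> /(_ _ i); rewrite mxE eqxx; apply => j; rewrite mxE.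
case: eqP => [->|_]; last by rewrite subrr normr0.
by rewrite ger0_norm ?subr_ge0// lerBlDl.
Qed.

Section one_coordinate.
Variables (u v : 'rV[R]_d -> R) (k : 'I_d) (c : 'rV[R]_d) (r B : R).
Variables (f : 'I_d -> R -> R) (P Q : R -> R).
Hypothesis uv : is_weak_partial k u v.
Hypothesis sf : forall i, smooth1 (f i).
Hypothesis fB : forall i t, `|f i t| <= B.
Hypothesis f0 : forall i t, ~ (`|t - c 0 i| <= r) -> f i t = 0.
Hypothesis sP : smooth1 P.
Hypothesis sQ : smooth1 Q.
Hypothesis P1 : forall t, `|P t| <= 1.
Hypothesis Q1 : forall t, `|Q t| <= 1.
Hypothesis PB : forall t, `|P^`()%classic t| <= B.
Hypothesis QB : forall t, `|Q^`()%classic t| <= B.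
Hypothesis P0 : forall t, ~ (`|t - c 0 k| <= r) -> P^`()%classic t = 0.
Hypothesis Q0 : forall t, ~ (`|t - c 0 k| <= r) -> Q^`()%classic t = 0.
Hypothesis PQ : forall t, ~ (`|t - c 0 k| <= r) -> P t = Q t.

Let integrable_upd (h : R -> R) : smooth1 h -> (forall t, `|h t| <= B) ->
  (forall t, ~ (`|t - c 0 k| <= r) -> h t = 0) ->
  mu.-integrable setT (EFin \o (fun z => u z * tensor (upd f k h) z)).
Proof.
move=> sh hB h0; have [[mu_ _] _ _] := uv.
apply: (@integrable_mul_cube _ _ _ _ c r (\prod_(i < d) B)) => //.
- apply: continuous_measurable_rV; apply: tensor_continuous => i.
  by rewrite /upd; case: ifP => _; exact: smooth1_continuous.
- by move=> z; apply: tensor_bound => i t; rewrite /upd; case: ifP.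
- move=> z /existsNP[i zi]; apply: (tensor_eq0 (i := i)).
  by rewrite /upd; case: eqP => [E|_]; [apply: h0; rewrite -E|exact: f0].
- by apply: locally_integrable_cube; case: uv.
Qed.

(** The two weights differ by the [k]-th partial derivative of the tensor product with factor
    [P \- Q]. This is a test function because [P] and [Q] agree far from [c], so the weak derivative
    applies; its size is at most 2 times one factor [B] for each other coordinate. *)
Lemma one_coordinate :
  (`|\int[mu]_z (u z * tensor (upd f k P^`()%classic) z) -
     \int[mu]_z (u z * tensor (upd f k Q^`()%classic) z)|%:E <=
   (2 * B ^+ d.-1)%:E * \int[mu]_(z in cube c r) `|v z|%:E)%E.
Proof.
have sPQ : smooth1 (P \- Q).
  move=> n; rewrite (_ : P \- Q = P \+ (cst (-1) \* Q)).
    by apply: diffnD => //; apply: diffnM => //; exact: diffn_cst.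
  by apply/funext => t /=; rewrite mulN1r.
have dPQ : (P \- Q)^`()%classic = P^`()%classic \- Q^`()%classic.
  apply/funext => t; rewrite derive1E; apply: derive_val.
  by apply: is_deriveB; exact: smooth1_is_derive.
have spsi i : smooth1 (upd f k (P \- Q) i) by rewrite /upd; case: ifP.
have psi0 z : ~ cube c r z -> tensor (upd f k (P \- Q)) z = 0.
  move=> /existsNP[i zi]; apply: (tensor_eq0 (i := i)).
  rewrite /upd; case: eqP => [E|_]; last exact: f0.
  by rewrite /= PQ ?subrr// -E.
rewrite -RintegralB//; last 2 first.
- by apply: integrable_upd => //; exact: smooth1_derive.
- by apply: integrable_upd => //; exact: smooth1_derive.
have [[mu_ _] [mv _] ibp] := uv.
have tpsi := tensor_test_function spsi psi0.
under eq_Rintegral do rewrite -mulrBr -tensorB_upd -dPQ.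
have -> : (fun x => u x * tensor (upd f k (P \- Q)^`()%classic) x) =
  (fun x => u x * 'D_'e_k (tensor (upd f k (P \- Q))) x).
  apply/funext => z; congr (_ * _); rewrite tensor_derive//.
  rewrite /tensor; apply: eq_bigr => j _; rewrite /upd eqxx.
  by case: eqP.
rewrite ibp// normrN.
apply: le_Rintegral_mul_cube => //.
- apply: continuous_measurable_rV; apply: tensor_continuous => i.
  exact: smooth1_continuous.
- move=> z; rewrite tensor_upd normrM ler_pM//.
    rewrite /= (le_trans (ler_normB _ _))//.
    by rewrite (_ : 2 = 1 + 1)// lerD.
  rewrite normr_prod (_ : B ^+ d.-1 = \prod_(j < d | j != k) B).
    by apply: ler_prod => j _; rewrite normr_ge0 fB.
  by rewrite prodr_const cardC1 card_ord.
Qed.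

End one_coordinate.

Section change_of_bump.
Variables (u : 'rV[R]_d -> R) (v : 'I_d -> 'rV[R]_d -> R).
Hypothesis uv : forall i, is_weak_partial i u (v i).

(* Replacing the one-dimensional factors one at a time, each replacement is a
   partial derivative of a test function. *)
Lemma change_of_bump F1 F2 c c1 c2 (r r1 r2 B : R) :
  0 <= r1 -> 0 <= r2 -> `|c1 - c| + r1 <= r -> `|c2 - c| + r2 <= r ->
  steps c1 r1 B F1 -> steps c2 r2 B F2 ->
  (`|\int[mu]_z (u z * bumped F1 z) - \int[mu]_z (u z * bumped F2 z)|%:E <=
   (2 * B ^+ d.-1)%:E * \sum_i \int[mu]_(z in cube c r) `|v i z|%:E)%E.
Proof.
move=> r10 r20 cr1 cr2 [sF1 F11 F1B] [sF2 F21 F2B].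
(* Coordinates below [k] already use [F2], the others still [F1]; consecutive hybrids differ in
   coordinate [k] only, and their integrals telescope. *)
pose hyb (k : nat) (j : 'I_d) := if (j < k)%N then F2 j else F1 j.
pose T k := \int[mu]_z (u z * bumped (hyb k) z).
have off1 i t : ~ (`|t - c 0 i| <= r) -> ~ (c1 0 i <= t <= c1 0 i + r1).
  by move=> h /(cube_coord cr1 r10).
have off2 i t : ~ (`|t - c 0 i| <= r) -> ~ (c2 0 i <= t <= c2 0 i + r2).
  by move=> h /(cube_coord cr2 r20).
have smF1 i : smooth1 (F1 i) by case: (sF1 i).
have smF2 i : smooth1 (F2 i) by case: (sF2 i).
have -> : \int[mu]_z (u z * bumped F1 z) = T 0%N by [].
have -> : \int[mu]_z (u z * bumped F2 z) = T d.
  by congr Rintegral; apply/funext => z; congr (_ * tensor _ _); apply/funext => j; rewrite /hyb ltn_ord.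
rewrite distrC -telescope_sumr// big_mkord.
apply: (@le_trans _ _ (\sum_(i < d) `|T i.+1 - T i|%:E)%E).
  by rewrite sumEFin lee_fin ler_norm_sum.
rewrite ge0_sume_distrr; last by move=> i _; exact: integral_ge0.
apply: lee_sum => k _; rewrite distrC.
pose f j := (hyb k j)^`()%classic.
have E1 : bumped (hyb k) = tensor (upd f k (F1 k)^`()%classic).
  congr tensor; apply/funext => j; rewrite /upd /f /hyb.
  by case: eqP => // ->; rewrite ltnn.
have E2 : bumped (hyb k.+1) = tensor (upd f k (F2 k)^`()%classic).
  congr tensor; apply/funext => j; rewrite /upd /f /hyb.
  case: eqP => [->|/eqP jk]; first by rewrite ltnSn.
  by rewrite ltnS leq_eqVlt (negbTE (_ : (j : nat) != k)).
rewrite /T E1 E2.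
apply: one_coordinate => //; rewrite /f /hyb.
- by move=> i; case: ifP => _; exact: smooth1_derive.
- by move=> i t; case: ifP.
- move=> i t h; case: ifP => _.
  + exact: (step_deriv0 (sF2 i) (@off2 _ _ h)).
  + exact: (step_deriv0 (sF1 i) (@off1 _ _ h)).
- move=> t h; exact: (step_deriv0 (sF1 k) (@off1 _ _ h)).
- move=> t h; exact: (step_deriv0 (sF2 k) (@off2 _ _ h)).
- move=> t h.
  (* Outside the interval of radius [r] around [c 0 k], a point lies before both steps, where both
     are 0, or after both, where both are 1. *)
  have lo j e : `|e - c| + j <= r -> 0 <= j -> t < c 0 k - r -> t <= e 0 k.
    move=> ej j0 tc; rewrite leNgt; apply/negP => et.
    have : `|e 0 k - c 0 k| <= r by apply: (cube_coord ej j0); rewrite lexx lerDl.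
    by rewrite ler_distl => /andP[]; lra.
  have hi j e : `|e - c| + j <= r -> 0 <= j -> c 0 k + r < t -> e 0 k + j <= t.
    move=> ej j0 tc; rewrite leNgt; apply/negP => et.
    have : `|e 0 k + j - c 0 k| <= r by apply: (cube_coord ej j0); rewrite lexx lerDl andbT.
    by rewrite ler_distl => /andP[]; lra.
  move/negP: h; rewrite ler_distl negb_and -!ltNge => /orP[tc|tc].
  + have [_ h1 _] := sF1 k; have [_ h2 _] := sF2 k.
    by rewrite (h1 _ (lo _ _ cr1 r10 tc)) (h2 _ (lo _ _ cr2 r20 tc)).
  + have [_ _ h1] := sF1 k; have [_ _ h2] := sF2 k.
    by rewrite (h1 _ (hi _ _ cr1 r10 tc)) (h2 _ (hi _ _ cr2 r20 tc)).
Qed.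

End change_of_bump.

End oscillation.

(** * Averages and dyadic sums *)

Section averages.
Variables (R : realType) (d : nat).
Local Notation mu := (lebesgue_rV R d).
Variables (H : R -> R) (M : R).
Hypothesis stepH : step 0 1 H.
Hypothesis H1 : forall t, `|H t| <= 1.
Hypothesis HM : forall t, `|H^`()%classic t| <= M.

Definition stepfam (c : 'rV[R]_d) (r : R) : 'I_d -> R -> R :=
  fun i t => H (r^-1 * (t - c 0 i)).

Definition avg (u : 'rV[R]_d -> R) c r : R := \int[mu]_z (u z * bumped (stepfam c r) z).

Lemma stepfamP c (r B : R) : 0 < r -> M / r <= B -> steps c r B (stepfam c r).
Proof.
move=> r0 MB; split => i; have [? ? FB] := scaled_step (c 0 i) r0 stepH H1 HM => //.
by move=> t; exact: le_trans (FB t) MB.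
Qed.

(** The bump has integral 1, so the difference is the integral of [u z - u c] against it; the height
    [(M / r) ^+ d] times the volume bound [(r *+ 2) ^+ d] no longer depends on [r]. *)
Lemma le_avgB (u : 'rV[R]_d -> R) c (r e : R) : 0 < r -> locally_integrable_rV u ->
  (forall z, cube c r z -> `|u z - u c| <= e) ->
  `|avg u c r - u c| <= (M *+ 2) ^+ d * e.
Proof.
move=> r0 lu ue; have [mu_ _] := lu.
have e0 : 0 <= e.
  apply: le_trans (ue c _); first exact: normr_ge0.
  by move=> i; rewrite subrr normr0 ltW.
have M0 : 0 <= M by apply: le_trans (HM 0).
have [sF _ FB] := stepfamP c r0 (lexx (M / r)).
have cF : continuous (bumped (stepfam c r)).
  by apply: step_tensor_continuous => i; have [] := sF i.
have mF := continuous_measurable_rV cF.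
have bF z : `|bumped (stepfam c r) z| <= (M / r) ^+ d.
  rewrite -[X in _ ^+ X]card_ord -prodr_const; apply: tensor_bound; exact: FB.
have F0 z : ~ cube c r z -> bumped (stepfam c r) z = 0 by exact: step_tensor_eq0.
have uF := integrable_mul_cube mu_ mF bF F0 (locally_integrable_cube _ _ lu).
have intF := step_tensor_integrable (ltW r0) sF FB.
have E : u c = \int[mu]_z (u c * bumped (stepfam c r) z).
  rewrite RintegralZl//= /Rintegral.
  by rewrite (integral_step_tensor r0 sF FB)/= mulr1.
have -> : avg u c r - u c = \int[mu]_z ((u z - u c) * bumped (stepfam c r) z).
  rewrite [X in _ - X]E /avg -RintegralB//.
    by apply: eq_Rintegral => z _; rewrite mulrBl.
  have := integrableZl measurableT (u c) intF.
  by under eq_fun do rewrite /= -EFinM.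
rewrite -lee_fin; apply: le_trans.
  apply: (@le_Rintegral_mul_cube _ _ (fun z => u z - u c) (bumped (stepfam c r))
    c r ((M / r) ^+ d)) => //.
  by apply: measurable_funB => //; exact: measurable_cst.
apply: (@le_trans _ _ (((M / r) ^+ d)%:E * \int[mu]_(z in cube c r) (cst e%:E z)))%E.
  rewrite lee_wpmul2l ?lee_fin ?exprn_ge0 ?divr_ge0 ?(ltW r0)//.
  apply: ge0_le_integral => //=.
  - exact: measurable_cube.
  - apply: measurable_funTS; apply/measurable_EFinP; apply: measurableT_comp => //.
    by apply: measurable_funB => //; exact: measurable_cst.
rewrite integral_cst; last exact: measurable_cube.
apply: (@le_trans _ _ (((M / r) ^+ d)%:E * (e%:E * ((r *+ 2) ^+ d)%:E)))%E.
  rewrite lee_wpmul2l ?lee_fin ?exprn_ge0 ?divr_ge0 ?(ltW r0)//.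
  by rewrite lee_wpmul2l ?lee_fin// lebesgue_cube_le// ltW.
by rewrite -!EFinM lee_fin mulrCA mulrC -exprMn mulrnAr divfK ?gt_eqF.
Qed.

Lemma avg_cvg (u : 'rV[R]_d -> R) c : continuous u -> locally_integrable_rV u ->
  forall e : R, 0 < e -> exists2 dl : R, 0 < dl & forall r, 0 < r <= dl -> `|avg u c r - u c| <= e.
Proof.
move=> cu lu e e0; set K := (M *+ 2) ^+ d + 1.
have M0 : 0 <= M by apply: le_trans (HM 0).
have K0 : 0 < K by rewrite ltr_wpDl// exprn_ge0// mulrn_wge0.
have eK : 0 < e / K by rewrite divr_gt0.
have /cvgrPdist_le/(_ _ eK)/nbhs_ballP[dl /= dl0 cdl] := cu c.
(* Halving puts the closed cube inside the open ball of radius [dl]. *)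
exists (dl / 2) => [|r /andP[r0 rdl]]; first by rewrite divr_gt0.
apply: (le_trans (le_avgB (e := e / K) r0 lu _)) => [z|].
  move=> /(cubeP _ _ (ltW r0)) zc; rewrite distrC; apply: cdl.
  rewrite mx_norm_ball /ball_/= distrC (le_lt_trans zc)// (le_lt_trans rdl)//.
  by rewrite ltr_pdivrMr// ltr_pMr// ltr1n.
by rewrite mulrCA ler_piMr ?(ltW e0)// ler_pdivrMr// mul1r /K lerDl.
Qed.

End averages.

(** * Geometric sums over dyadic scales *)

Section dyadic_sums.
Variable R : realType.

Lemma sum_halves_le N (a : R) : 0 <= a -> \sum_(j < N) a / 2 ^+ j <= a *+ 2.
Proof.
elim: N a => [|N ih] a a0; first by rewrite big_ord0 mulrn_wge0.
rewrite big_ord_recl expr0 divr1 mulr2n lerD2l.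
have := ih (a / 2); rewrite divr_ge0// => /(_ isT); rewrite (_ : a / 2 *+ 2 = a); last by rewrite mulr2n -splitr.
apply: le_trans; apply: ler_sum => j _; rewrite exprS/= invfM mulrA.
by rewrite le_eqVlt; apply/orP; left; apply/eqP.
Qed.

(** The terms kept are the tail of a geometric sequence starting at its first value not above [t],
    so they add up to at most twice that value. *)
Lemma sum_small_halves_le N (a t : R) : 0 <= a -> 0 <= t ->
  \sum_(j < N) (if a / 2 ^+ j <= t then a / 2 ^+ j else 0) <= t *+ 2.
Proof.
move=> + t0; elim: N a => [|N ih] a a0; first by rewrite big_ord0 mulrn_wge0.
have [at_|ta] := leP a t.
  apply: (@le_trans _ _ (a *+ 2)); last by rewrite ler_wMn2r.
  apply: le_trans (sum_halves_le N.+1 a0); apply: ler_sum => j _.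
  by case: ifP => // _; rewrite divr_ge0// exprn_ge0.
rewrite big_ord_recl expr0 divr1 [a <= t]leNgt ta/= add0r.
have := ih (a / 2); rewrite divr_ge0// => /(_ isT); apply: le_trans.
by apply: ler_sum => j _; rewrite exprS/= invfM mulrA.
Qed.

Lemma sum_doubling_le (b : nat -> R) N : (forall j, 0 <= b j) ->
  (forall j, b j *+ 2 <= b j.+1) -> \sum_(j < N) b j <= b N.
Proof.
move=> b0 b2; elim: N => [|N ih]; first by rewrite big_ord0.
by rewrite big_ord_recr/=; apply: le_trans (b2 N); rewrite mulr2n lerD2r.
Qed.

(** By doubling, each term dominates the sum of all earlier ones; the sum is thus at most twice the
    last term kept. *)
Lemma sum_small_doubling_le (b : nat -> R) N (B : R) : 0 <= B ->
  (forall j, 0 <= b j) -> (forall j, b j *+ 2 <= b j.+1) ->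
  \sum_(j < N) (if b j <= B then b j else 0) <= B *+ 2.
Proof.
move=> B0 b0 b2; elim: N => [|N ih]; first by rewrite big_ord0 mulrn_wge0.
rewrite big_ord_recr/=; case: ifPn => [bB|_]; last by rewrite addr0.
rewrite mulr2n lerD//; apply: le_trans bB; apply: le_trans (sum_doubling_le N b0 b2).
by apply: ler_sum => j _; case: ifP.
Qed.

(* Splitting at the scale [t]: small cubes are estimated by their volume,
   large ones by [m]. *)
Lemma sum_scales_le (d N : nat) (a t m : R) (w : nat -> R) : (2 <= d)%N ->
  0 < a -> 0 < t -> 0 <= m ->
  (forall j, 0 <= w j <= m) -> (forall j, w j <= ((a / 2 ^+ j) *+ 2) ^+ d) ->
  \sum_(j < N) (a / 2 ^+ j)^-1 ^+ d.-1 * w j <=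
  2 ^+ d.+1 * (t + t^-1 ^+ d.-1 * m).
Proof.
move=> d2 a0 t0 m0 wm wd; pose l j := a / 2 ^+ j; pose b j := (l j)^-1 ^+ d.-1.
have l0 j : 0 < l j by rewrite divr_gt0// exprn_gt0.
have b0 j : 0 <= b j by rewrite exprn_ge0// invr_ge0 ltW.
(* The hypothesis [2 <= d] enters here: halving the scale multiplies [b] by [2 ^+ d.-1], which is at
   least 2. *)
have b2 j : b j *+ 2 <= b j.+1.
  rewrite -mulr_natr /b (_ : (l j.+1)^-1 = (l j)^-1 * 2); last first.
    by rewrite /l exprSr [X in a * X]invfM mulrA [LHS]invfM invrK.
  rewrite exprMn ler_wpM2l//; first exact: b0.
  apply: (@ler_weXn2l _ (2 : R) _ 1 d.-1); first by rewrite ler1n.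
  by rewrite -ltnS prednK// (leq_trans _ d2).
have dE : d = d.-1.+1 by rewrite prednK// (leq_trans _ d2).
pose B := t^-1 ^+ d.-1.
have B0 : 0 <= B by rewrite exprn_ge0// invr_ge0 ltW.
apply: (@le_trans _ _ (\sum_(j < N) (2 ^+ d * (if l j <= t then l j else 0) +
   (if b j <= B then b j else 0) * m))).
  apply: ler_sum => j _; rewrite -/(l j) -/(b j).
  have [w0 wmj] := andP (wm j).
  have [lt_|tl] := leP (l j) t.
    rewrite -[leLHS]addr0 lerD//; last by case: ifP => _; rewrite ?mul0r ?mulr_ge0.
    apply: le_trans (ler_wpM2l (b0 j) (wd j)) _.
    rewrite -/(l j) -mulr_natl exprMn mulrCA ler_wpM2l ?exprn_ge0//.
    rewrite /b {2}dE exprS mulrCA -exprMn mulVf ?gt_eqF// expr1n mulr1//.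
  rewrite mulr0 add0r ifT; first by rewrite ler_wpM2l.
  by rewrite /b /B lerXn2r// ?nnegrE ?invr_ge0 ?(ltW t0) ?(ltW (l0 j))// lef_pV2 ?posrE// ltW.
rewrite big_split/= -mulr_sumr -mulr_suml mulrDr lerD//.
  rewrite exprSr -mulrA ler_wpM2l ?exprn_ge0// mulr_natl.
  exact: sum_small_halves_le (ltW a0) (ltW t0).
rewrite mulrA ler_wpM2r//; apply: le_trans (sum_small_doubling_le N B0 b0 b2) _.
rewrite (_ : B *+ 2 = 2 * B); last by rewrite mulr_natl.
by rewrite ler_wpM2r// exprS ler_peMr// exprn_ege1// ler1n.
Qed.

End dyadic_sums.

(** * Level sets and the Lorentz norm *)

Section layers.
Context {disp} {T : measurableType disp} {R : realType}.
Variable mu : {measure set T -> \bar R}.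
Variables (eps : R) (g : T -> R).
Hypothesis eps0 : 0 < eps.
Hypothesis mg : measurable_fun setT g.

Definition level (k : nat) : R := eps * 2 ^+ k.
Definition superlevel (k : nat) : set T := [set x | level k < g x].

Lemma level_gt0 k : 0 < level k.
Proof. by rewrite mulr_gt0// exprn_gt0. Qed.

Lemma levelS k : level k.+1 = level k *+ 2.
Proof. by rewrite /level exprSr mulrA mulr_natr. Qed.

Lemma measurable_superlevel k : measurable (superlevel k).
Proof.
rewrite (_ : superlevel k = g @^-1` `]level k, +oo[); last first.
  by apply/seteqP; split=> x /=; rewrite in_itv/= andbT.
by rewrite -[X in measurable X]setTI; exact: mg.
Qed.

(** If [g x > eps], let [n.+1] be the least index with [g x <= level n.+1]; then [x] is in
    [superlevel n] and the single term [level n *+ 2] already dominates [g x]. *)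
Lemma le_level_sum x : 0 <= g x ->
  ((g x)%:E <= eps%:E + \sum_(0 <= k <oo) ((level k *+ 2) * \1_(superlevel k) x)%:E)%E.
Proof.
move=> g0; have t0 k : (0 <= ((level k *+ 2) * \1_(superlevel k) x)%:E)%E.
  by rewrite lee_fin mulr_ge0// mulrn_wge0// ltW// level_gt0.
have [ge|eg] := leP (g x) eps.
  rewrite -[leLHS]adde0 leeD ?lee_fin//; exact: nneseries_ge0.
have ex : exists n, g x <= level n.
  have [n ng] := @ltr_add_invr R 0 (eps / g x) (divr_gt0 eps0 (lt_trans eps0 eg)).
  exists n; rewrite /level.
  rewrite add0r ltr_pdivlMr ?(lt_trans eps0 eg)// mulrC ltr_pdivrMr// in ng.
  apply: (le_trans (ltW ng)); rewrite ler_pM2l//.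
  by rewrite -natrX ler_nat ltn_expl.
have [[|n] ng nmin] := ex_minnP ex.
  by move: ng; rewrite /level expr0 mulr1 leNgt eg.
have gn : superlevel n x.
  by rewrite /superlevel/= ltNge; apply/negP => /nmin; rewrite ltnn.
apply: (@le_trans _ _ ((level n *+ 2) * \1_(superlevel n) x)%:E).
  by rewrite lee_fin -levelS indicE mem_set// mulr1.
rewrite -[leLHS]add0e leeD ?lee_fin ?(ltW eps0)//.
apply: le_trans (nneseries_lim_ge n.+1 _) => //.
by rewrite big_nat_recr//= leeDr// sume_ge0.
Qed.

Lemma integral_le_levels (D : set T) : measurable D -> (forall x, 0 <= g x) ->
  (\int[mu]_(x in D) (g x)%:E <= eps%:E * mu D +
     \sum_(0 <= k <oo) (level k *+ 2)%:E * mu (superlevel k `&` D))%E.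
Proof.
move=> mD g0.
have l0 k : 0 <= level k *+ 2 by rewrite mulrn_wge0// ltW// level_gt0.
have mt k : measurable_fun D (fun x => ((level k *+ 2) * \1_(superlevel k) x)%:E).
  apply/measurable_EFinP; apply: measurable_funM => //.
  exact: measurable_indic (measurable_superlevel k).
have t0 k x : D x -> (0 <= ((level k *+ 2) * \1_(superlevel k) x)%:E)%E.
  by move=> _; rewrite lee_fin mulr_ge0.
have E : (\sum_(0 <= k <oo) (level k *+ 2)%:E * mu (superlevel k `&` D) =
    \int[mu]_(x in D) \sum_(0 <= k <oo) ((level k *+ 2) * \1_(superlevel k) x)%:E)%E.
  rewrite integral_nneseries//; apply: eq_eseriesr => k _.
  under eq_integral do rewrite EFinM.
  rewrite ge0_integralZl_EFin ?integral_indic//.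
  - exact: measurable_superlevel.
  - apply/measurable_EFinP; exact: measurable_indic (measurable_superlevel k).
have ms : measurable_fun D (fun x => \sum_(0 <= k <oo) ((level k *+ 2) * \1_(superlevel k) x)%:E)%E.
  by apply: ge0_emeasurable_sum => // k x Dx _; exact: t0.
have s0 x : D x -> (0 <= \sum_(0 <= k <oo) ((level k *+ 2) * \1_(superlevel k) x)%:E)%E.
  by move=> Dx; apply: nneseries_ge0 => k _ _; exact: t0.
rewrite E -(integral_cst mu mD eps%:E) -ge0_integralD//; last first.
  by move=> x _; rewrite lee_fin ltW.
apply: ge0_le_integral => //.
- by move=> x _; rewrite lee_fin.
- by apply/measurable_EFinP; exact: measurable_funTS.
- exact: emeasurable_funD.
- by move=> x _; exact: le_level_sum.
Qed.

End layers.

Section lorentz_lower_bound.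
Context {disp} {T : measurableType disp} {R : realType}.
Variable mu : {measure set T -> \bar R}.

Lemma nneseries_le_bound (f : nat -> \bar R) x : (forall k, 0 <= f k)%E ->
  (forall n, \sum_(0 <= k < n) f k <= x)%E -> (\sum_(0 <= k <oo) f k <= x)%E.
Proof.
move=> f0 fx; apply: lime_le; first exact: is_cvg_nneseries.
exact: nearW.
Qed.

(** The integral of a nonnegative function is a supremum over the simple functions below it, so
    monotonicity holds for arbitrary functions, in particular for the integrand of the Lorentz
    norm. *)
Lemma ge0_le_integralW (f h : T -> \bar R) : (forall x, 0 <= f x)%E ->
  (forall x, f x <= h x)%E -> (\int[mu]_x f x <= \int[mu]_x h x)%E.
Proof.
move=> f0 fh; rewrite !ge0_integralTE//; last first.
  by move=> x; exact: le_trans (fh x).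
apply: le_ereal_sup => _ [k kf <-]; exists k => //= x.
exact: le_trans (kf x) (fh x).
Qed.

End lorentz_lower_bound.

(** * Dyadic lower bound for the Lorentz norm *)

Section lorentz_dyadic.
Context {disp} {T : measurableType disp} {R : realType}.
Variable mu : {measure set T -> \bar R}.
Variables (eps : R) (g : T -> R).
Hypothesis eps0 : 0 < eps.
Hypothesis mg : measurable_fun setT g.
Hypothesis g0 : forall x, 0 <= g x.
Variables (d : nat) (b : nat -> R).
Hypothesis d0 : (0 < d)%N.
Hypothesis b0 : forall k, 0 <= b k.
Hypothesis bmu : forall k, ((b k)%:E <= mu (superlevel eps g k))%E.
Local Notation level := (level eps).
Local Notation leb := (@lebesgue_measure R).

(** Let [s] be admissible in the infimum defining the rearrangement. A level above [s] has a
    superlevel set of measure at most [t], so its indicator vanishes at [t]; the levels up to [s]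
    double at each step and sum to at most [2 * s]. *)
Lemma rearrangement_ge (t : R) :
  (\sum_(0 <= k <oo) (level k * \1_(`]0, b k[%classic) t)%:E <=
   2%:E * decreasing_rearrangement mu g t)%E.
Proof.
apply: nneseries_le_bound => [k|n].
  by rewrite lee_fin mulr_ge0// ltW// level_gt0.
rewrite -lee_pdivrMl//; apply: le_ereal_inf_tmp => _ [s [s0 smu] <-].
rewrite lee_pdivrMl// sumEFin -EFinM lee_fin big_mkord.
have dbl k : level k *+ 2 <= level k.+1 by rewrite levelS.
have l0 k : 0 <= level k by rewrite ltW// level_gt0.
have h := sum_small_doubling_le n s0 l0 dbl.
rewrite (_ : 2 * s = s *+ 2); last by rewrite mulr_natl.
apply: le_trans h.
apply: ler_sum => k _; rewrite indicE; case: ifPn => [_|].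
  by rewrite ler_piMr ?(ltW (level_gt0 eps0 k))//; case: (_ \in _).
rewrite -ltNge => sk; rewrite memNset ?mulr0//= in_itv/= => /andP[_ tb].
have : ((b k)%:E <= t%:E)%E.
  apply: le_trans (bmu k) _; apply: le_trans smu; apply: le_measure.
  - by rewrite inE; exact: measurable_superlevel.
  - rewrite inE (_ : [set x | _] = g @^-1` `]s, +oo[).
      by rewrite -[X in measurable X]setTI; exact: mg.
    by apply/seteqP; split=> x /=; rewrite in_itv/= andbT ger0_norm.
  - by move=> x /=; rewrite /superlevel/= ger0_norm//; exact: lt_trans.
by rewrite lee_fin leNgt tb.
Qed.

(** The power t^(p-1) is nonincreasing. On []0, b k[] the weight of the Lorentz norm may therefore
    be replaced by its value at [b k], leaving only integrals of indicators. *)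
Lemma powR_div_le (p t c : R) : 0 <= p <= 1 -> 0 < t <= c -> c `^ p / c <= t `^ p / t.
Proof.
move=> /andP[p0 p1] /andP[t0 tc]; have c0 := lt_le_trans t0 tc.
have q1 : 1 <= c / t by rewrite ler_pdivlMr// mul1r.
have {1}-> : c = t * (c / t) by rewrite mulrC divfK ?gt_eqF.
rewrite powRM ?divr_ge0 ?(ltW t0) ?(ltW c0)// -mulrA ler_wpM2l ?powR_ge0//.
rewrite ler_pdivrMr// mulrC; have := ler_powR q1 p1.
by rewrite powRr1 ?(mulrC t^-1)// divr_ge0 ?ltW.
Qed.

(* Dyadic form of the layer-cake lower bound for the Lorentz norm; [b] only
   approximates the distribution function from below, so that the latter may
   still be infinite. *)
Lemma lorentz1_norm_ge :
  (\sum_(0 <= k <oo) (level k * b k `^ d%:R^-1)%:E <= 2%:E * lorentz1_norm mu d%:R g)%E.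
Proof.
pose p : R := d%:R^-1.
have p0 : 0 < p by rewrite invr_gt0 ltr0n.
have p1 : p <= 1 by rewrite invf_le1 ?ler1n ?ltr0n.
(* Chosen so that [w k] times the length [b k] of the interval is the [k]-th term of the sum; if
   [b k = 0] both vanish. *)
pose w k : R := level k * (b k `^ p / b k).
have w0 k : 0 <= w k by rewrite mulr_ge0 ?divr_ge0 ?powR_ge0// ltW// level_gt0.
pose f k (t : measurableTypeR R) : \bar R := (w k * \1_(`]0, b k[%classic) t)%:E.
have f0 k t : (0 <= f k t)%E by rewrite lee_fin mulr_ge0.
have mf k (D : set R) : measurable_fun D (f k).
  apply: measurable_funTS; apply/measurable_EFinP; apply: measurable_funM => //.
have intf k : (\int[leb]_(t in `]0%R, +oo[) f k t = (level k * b k `^ p)%:E)%E.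
  under eq_integral do rewrite /f EFinM.
  rewrite ge0_integralZl_EFin//; last first.
    by apply/measurable_EFinP; exact: measurable_indic.
  rewrite integral_indic// (_ : _ `&` _ = `]0, b k[%classic); last first.
    by apply/seteqP; split => t /=; rewrite !in_itv/= ?andbT; [case|move=> /[dup] ? /andP[]].
  have /= E := @lebesgue_measure_itv R `]0, b k[.
  have -> : lebesgue_measure `]0%R, b k[%classic = (b k)%:E.
    rewrite [LHS]E lte_fin; case: ifPn => [_|]; first by rewrite sube0.
    by rewrite -leNgt => bk; congr EFin; apply/eqP; rewrite eq_le bk b0.
  rewrite -EFinM /w -mulrA; congr (_ * _)%:E.
  have [bk|bk] := eqVneq (b k) 0; last by rewrite divfK.
  by rewrite bk mulr0 powR0// gt_eqF.
rewrite -lee_pdivrMl//.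
have -> : (\sum_(0 <= k <oo) (level k * b k `^ p)%:E =
    \int[leb]_(t in `]0%R, +oo[) \sum_(0 <= k <oo) f k t)%E.
  rewrite integral_nneseries//; last by move=> n; exact: mf.
  by apply: eq_eseriesr => k _; rewrite intf.
have F0 t : (0 <= \sum_(0 <= k <oo) f k t)%E by apply: nneseries_ge0.
pose I : set (measurableTypeR R) := `]0%R, +oo[%classic.
have mI : measurable I by exact: measurable_itv.
have mF : measurable_fun I (fun t => \sum_(0 <= k <oo) f k t)%E.
  by apply: ge0_emeasurable_sum => [k t _ _|k _]; [exact: f0|exact: mf].
have half0 : 0 <= 2^-1 :> R by [].
rewrite -(@ge0_integralZl_EFin _ _ _ leb _ mI _ (fun t _ => F0 t) mF _ half0).
rewrite /lorentz1_norm integral_mkcond [leRHS]integral_mkcond.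
have h0 t : (0 <= 2^-1%:E * \sum_(0 <= k <oo) f k t)%E.
  by rewrite mule_ge0// nneseries_ge0.
apply: ge0_le_integralW => t; first by rewrite erestrict_ge0.
rewrite !patchE; case: ifPn => //; rewrite inE /I/= in_itv/= andbT => t0.
have c0 : 0 < t `^ p / t by rewrite divr_gt0// powR_gt0.
rewrite lee_pdivrMl//.
apply: (@le_trans _ _ ((t `^ p / t)%:E *
    \sum_(0 <= k <oo) (level k * \1_(`]0%R, b k[%classic) t)%:E)%E).
  rewrite -nneseriesZl; last first.
    by move=> k _; rewrite lee_fin mulr_ge0// ltW// level_gt0.
  apply: lee_nneseries => // k _; rewrite /f -EFinM lee_fin indicE.
  case: (boolP (t \in _)) => [|_]; last by rewrite !mulr0.
  rewrite inE/= in_itv/= => /andP[_ tb]; rewrite !mulr1 /w mulrC.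
  rewrite ler_wpM2r ?(ltW (level_gt0 eps0 k))//; apply: powR_div_le.
    by rewrite (ltW p0).
  by rewrite t0 ltW.
apply: le_trans (lee_wpmul2l _ (rearrangement_ge t)) _.
  by rewrite lee_fin ltW.
by rewrite EFinM muleCA lee_wpmul2l// -!muleA lee_wpmul2l ?lee_fin ?powR_ge0// muleC.
Qed.

End lorentz_dyadic.

(** * The two-point estimate *)

Lemma sume_cst (R : realType) n (x : \bar R) : (\sum_(i < n) x = n%:R%:E * x)%E.
Proof.
by rewrite mule_natl; elim: n => [|n ih]; rewrite ?big_ord0// big_ord_recl ih muleS.
Qed.

Section two_points.
Variables (R : realType) (d : nat).
Hypothesis d2 : (2 <= d)%N.
Local Notation mu := (lebesgue_rV R d).
Variables (H : R -> R) (M : R).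
Hypothesis stepH : step 0 1 H.
Hypothesis H1 : forall t, `|H t| <= 1.
Hypothesis HM : forall t, `|H^`()%classic t| <= M.
Hypothesis M0 : 0 <= M.
Variables (u : 'rV[R]_d -> R) (v : 'I_d -> 'rV[R]_d -> R) (g : 'rV[R]_d -> R).
Hypothesis cu : continuous u.
Hypothesis uv : forall i, is_weak_partial i u (v i).
Hypothesis mg : measurable_fun setT g.
Hypothesis g0 : forall z, 0 <= g z.
Hypothesis vg : forall i z, `|v i z| <= g z.
Variable eps : R.
Hypothesis eps0 : 0 < eps.
Local Notation level := (level eps).
Local Notation E_ := (superlevel eps g).
Implicit Types (c x y z : 'rV[R]_d).

(** The bound of [change_of_bump] with [B = 2 * M / r], which controls the slopes of the steps at
    scale [r] and at scale [r / 2] alike. *)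
Definition osc_term c (r : R) : \bar R :=
  ((2 * (2 * M / r) ^+ d.-1)%:E * \sum_i \int[mu]_(z in cube c r) `|v i z|%:E)%E.

Lemma chain_avg c (a : R) N : 0 < a ->
  (`|avg H u c (a / 2 ^+ N) - avg H u c a|%:E <= \sum_(j < N) osc_term c (a / 2 ^+ j))%E.
Proof.
move=> a0; have l0 j : 0 < a / 2 ^+ j by rewrite divr_gt0// exprn_gt0.
elim: N => [|N ih]; first by rewrite expr0 divr1 subrr normr0 big_ord0.
rewrite big_ord_recr/=.
apply: (@le_trans _ _ (`|avg H u c (a / 2 ^+ N) - avg H u c a|%:E +
   `|avg H u c (a / 2 ^+ N.+1) - avg H u c (a / 2 ^+ N)|%:E)%E).
  by rewrite -EFinD lee_fin [leRHS]addrC; exact: ler_distD.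
apply: leeD => //.
have lS : a / 2 ^+ N.+1 = a / 2 ^+ N / 2 by rewrite exprSr invfM mulrA.
apply: (@change_of_bump _ _ u v uv _ _ c c c _ _ _ (2 * M / (a / 2 ^+ N))
  (ltW (l0 N.+1)) (ltW (l0 N))).
- by rewrite subrr normr0 add0r lS ler_pdivrMr// ler_peMr ?ler1n// ltW.
- by rewrite subrr normr0 add0r.
- apply: (stepfamP stepH H1 HM) => //.
  by rewrite lS invfM invrK [_^-1 * 2]mulrC mulrA [M * 2]mulrC.
- apply: (stepfamP stepH H1 HM) => //.
  by rewrite ler_wpM2r ?invr_ge0 ?(ltW (l0 N))// ler_peMl// ler1n.
Qed.

(** Both bumps are supported in [cube x (2 * r)], so one change of bump moves the base point from
    [x] to [y]. *)
Lemma link_avg x y (r : R) : 0 < r -> `|y - x| <= r ->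
  (`|avg H u y r - avg H u x (2 * r)|%:E <= osc_term x (2 * r))%E.
Proof.
move=> r0 yx; have r20 : 0 < 2 * r by rewrite mulr_gt0.
have E : M / r = 2 * M / (2 * r) by rewrite invfM mulrACA divff ?mul1r.
apply: (@change_of_bump _ _ u v uv _ _ x y x _ _ _ (2 * M / (2 * r))
  (ltW r0) (ltW r20)).
- by rewrite mulr2n mulrDl mul1r lerD2r.
- by rewrite subrr normr0 add0r.
- by apply: (stepfamP stepH H1 HM) => //; rewrite E.
- apply: (stepfamP stepH H1 HM) => //.
  by rewrite ler_wpM2r ?invr_ge0 ?(ltW r20)// ler_peMl// ler1n.
Qed.

Section chain_bound.
Variables (Q : set 'rV[R]_d) (tau : nat -> R).
Hypothesis mQ : measurable Q.
Hypothesis Qoo : (mu Q < +oo)%E.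
Hypothesis tau0 : forall k, 0 <= tau k.
Hypothesis tauE : forall k, 0 < tau k \/ mu (E_ k) = 0.

(** The share of level [k] in a chain: [tau k] is the scale at which the estimate switches from the
    volume of the cube to the measure of the level set. For a null level set [tau k = 0] is allowed,
    its inverse being 0 by convention. *)
Definition level_term k : \bar R :=
  ((level k)%:E * ((tau k)%:E + ((tau k)^-1 ^+ d.-1)%:E * mu (E_ k `&` Q)))%E.

(** The first two factors come from [osc_term], [d] from bounding each [v i] by [g], and [2 ^+ d.+2]
    from [sum_scales_le] and the factor 2 in the layer decomposition. *)
Definition chain_cst : R := 2 * (2 * M) ^+ d.-1 * d%:R * 2 ^+ d.+2.

Lemma level_term_ge0 k : (0 <= level_term k)%E.
Proof.
rewrite mule_ge0 ?lee_fin ?(ltW (level_gt0 eps0 k))// adde_ge0 ?lee_fin//.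
by rewrite mule_ge0// lee_fin exprn_ge0// invr_ge0.
Qed.

Lemma sum_grad_le c (r : R) :
  (\sum_i \int[mu]_(z in cube c r) `|v i z|%:E <=
   d%:R%:E * (eps%:E * mu (cube c r) +
     \sum_(0 <= k <oo) (level k *+ 2)%:E * mu (E_ k `&` cube c r)))%E.
Proof.
have mc := @measurable_cube R d c r.
apply: (@le_trans _ _ (\sum_(i < d) \int[mu]_(z in cube c r) (g z)%:E)%E).
  apply: lee_sum => i _; apply: ge0_le_integral => //.
  - apply: measurable_funTS; apply/measurable_EFinP; apply: measurableT_comp => //.
    by have [_ []] := uv i.
  - by apply: measurable_funTS; exact/measurable_EFinP.
  - by move=> z _; rewrite lee_fin.
rewrite sume_cst lee_wpmul2l//; exact: integral_le_levels.
Qed.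

(** This is [sum_scales_le] for the measures of [E_ k] in the shrinking cubes, bounded both by the
    volume and by the measure in [Q]. A null level set is treated apart, since there [tau k] may be
    0 and a positive splitting scale is required. *)
Lemma chain_level c (a : R) N k : 0 < a -> cube c a `<=` Q ->
  (\sum_(j < N) ((a / 2 ^+ j)^-1 ^+ d.-1)%:E * mu (E_ k `&` cube c (a / 2 ^+ j)) <=
   (2 ^+ d.+1)%:E * ((tau k)%:E + ((tau k)^-1 ^+ d.-1)%:E * mu (E_ k `&` Q)))%E.
Proof.
move=> a0 aQ; have l0 j : 0 < a / 2 ^+ j by rewrite divr_gt0// exprn_gt0.
have mE := measurable_superlevel eps mg k.
have sub j : E_ k `&` cube c (a / 2 ^+ j) `<=` E_ k `&` Q.
  apply: setIS; apply: subset_trans aQ; apply: cube_sub; first exact: ltW.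
  by rewrite subrr normr0 add0r ler_pdivrMr ?exprn_gt0// ler_peMr ?(ltW a0)// exprn_ege1// ler1n.
have mm j : measurable (E_ k `&` cube c (a / 2 ^+ j)).
  by apply: measurableI => //; exact: measurable_cube.
have le_mu j : (mu (E_ k `&` cube c (a / 2 ^+ j)) <= mu (E_ k `&` Q))%E.
  by apply: le_measure; rewrite ?inE//; exact: measurableI.
have [tk|Ek0] := tauE k; last first.
  have mu0 : mu (E_ k `&` Q) = 0%E.
    apply/eqP; rewrite eq_le measure_ge0 andbT -Ek0.
    by apply: le_measure; rewrite ?inE//; exact: measurableI.
  rewrite big1 => [|j _]; last first.
    have := le_mu j; rewrite mu0 => h.
    by rewrite (_ : mu _ = 0%E) ?mule0//; apply/eqP; rewrite eq_le h measure_ge0.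
  by rewrite mu0 mule0 adde0 -EFinM lee_fin mulr_ge0.
have fin : (mu (E_ k `&` Q) < +oo)%E.
  apply: le_lt_trans Qoo; apply: le_measure; rewrite ?inE//; exact: measurableI.
have fin_j j : mu (E_ k `&` cube c (a / 2 ^+ j)) \is a fin_num.
  by rewrite ge0_fin_numE// (le_lt_trans (le_mu j)).
have finQ : mu (E_ k `&` Q) \is a fin_num by rewrite ge0_fin_numE.
pose w j := fine (mu (E_ k `&` cube c (a / 2 ^+ j))).
rewrite -(fineK finQ).
under eq_bigr do rewrite -(fineK (fin_j _)) -EFinM.
rewrite sumEFin -[leRHS]/((2 ^+ d.+1 * (tau k +
  (tau k)^-1 ^+ d.-1 * fine (mu (E_ k `&` Q))))%:E) lee_fin.
apply: (@sum_scales_le _ d N a (tau k) _ w) => //.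
- exact: fine_ge0.
- by move=> j; rewrite fine_ge0//= fine_le.
- move=> j; rewrite -lee_fin fineK//.
  apply: le_trans (lebesgue_cube_le c (ltW (l0 j))).
  apply: le_measure; rewrite ?inE//; exact: measurable_cube.
Qed.

(** The sums over scales and over levels are exchanged and [chain_level] bounds each level. The part
    below [eps] contributes a multiple of the scale itself at every step, hence a geometric
    series. *)
Lemma chain_bound c (a : R) N : 0 < a -> cube c a `<=` Q ->
  (\sum_(j < N) osc_term c (a / 2 ^+ j) <=
   chain_cst%:E * ((eps * a)%:E + \sum_(0 <= k <oo) level_term k))%E.
Proof.
move=> a0 aQ; have l0 j : 0 < a / 2 ^+ j by rewrite divr_gt0// exprn_gt0.
pose K : R := 2 * (2 * M) ^+ d.-1 * d%:R.
have K0 : 0 <= K by rewrite !mulr_ge0// exprn_ge0// mulr_ge0.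
pose w j : R := (a / 2 ^+ j)^-1 ^+ d.-1.
have w0 j : 0 <= w j by rewrite exprn_ge0// invr_ge0 ltW.
pose q j := cube c (a / 2 ^+ j).
have lev0 k : 0 <= level k *+ 2 by rewrite mulrn_wge0// ltW// level_gt0.
have s0 j : (0 <= \sum_(0 <= k <oo) (level k *+ 2)%:E * mu (E_ k `&` q j))%E.
  by apply: nneseries_ge0 => k _ _; rewrite mule_ge0 ?lee_fin.
have e0 j : (0 <= eps%:E * mu (q j))%E by rewrite mule_ge0// lee_fin ltW.
have es0 j : (0 <= eps%:E * mu (q j) +
    \sum_(0 <= k <oo) (level k *+ 2)%:E * mu (E_ k `&` q j))%E.
  by apply: adde_ge0; [exact: e0|exact: s0].
apply: (@le_trans _ _ (\sum_(j < N) K%:E * ((w j)%:E * (eps%:E * mu (q j) +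
    \sum_(0 <= k <oo) (level k *+ 2)%:E * mu (E_ k `&` q j))))%E).
  apply: lee_sum => j _; rewrite /osc_term.
  apply: (le_trans (lee_wpmul2l _ (sum_grad_le c (a / 2 ^+ j)))).
    by rewrite lee_fin mulr_ge0// exprn_ge0// divr_ge0 ?mulr_ge0// ltW.
  rewrite !muleA -!EFinM lee_wpmul2r//; first exact: es0.
  by rewrite lee_fin le_eqVlt /K /w exprMn; apply/orP; left; apply/eqP; ring.
rewrite -ge0_sume_distrr; last first.
  by move=> j _; rewrite mule_ge0 ?lee_fin// es0.
have -> : (chain_cst%:E = K%:E * (2 ^+ d.+2)%:E)%E by rewrite -EFinM.
rewrite -muleA lee_wpmul2l//.
under eq_bigr => j _ do rewrite ge0_muleDr ?mule_ge0 ?lee_fin ?(ltW eps0)//.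
rewrite big_split/= ge0_muleDr; last 2 first.
- by rewrite lee_fin mulr_ge0// ltW.
- by apply: nneseries_ge0 => k _ _; exact: level_term_ge0.
apply: leeD.
  apply: (@le_trans _ _ (\sum_(j < N) (eps * 2 ^+ d * (a / 2 ^+ j))%:E)%E).
    apply: lee_sum => j _; rewrite muleCA -mulrA EFinM lee_wpmul2l ?lee_fin ?(ltW eps0)//.
    apply: (le_trans (lee_wpmul2l _ (lebesgue_cube_le c (ltW (l0 j))))); first by rewrite lee_fin.
    rewrite -EFinM lee_fin -(mulr_natl (a / 2 ^+ j)) exprMn mulrCA ler_wpM2l ?exprn_ge0//.
    rewrite /w -{2}(prednK (ltnW d2)) exprS mulrCA -exprMn mulVf ?gt_eqF//.
    by rewrite expr1n mulr1.
  rewrite sumEFin -EFinM lee_fin -mulr_sumr.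
  apply: le_trans (ler_wpM2l _ (sum_halves_le N (ltW a0))) _.
    by rewrite mulr_ge0 ?exprn_ge0// ltW.
  have -> : 2 ^+ d.+2 * (eps * a) = eps * 2 ^+ d * (a *+ 2) *+ 2 by rewrite !exprS; ring.
  by rewrite mulr2n lerDl !mulr_ge0 ?exprn_ge0 ?mulrn_wge0// ltW.
rewrite -nneseriesZl; last by move=> k _; exact: level_term_ge0.
under eq_bigr => j _.
  rewrite -nneseriesZl; last by move=> k _; rewrite mule_ge0 ?lee_fin.
  over.
rewrite -nneseries_sum; last by move=> j k _; rewrite !mule_ge0 ?lee_fin.
apply: lee_nneseries => [k _ _|k _].
  by apply: sume_ge0 => j _; rewrite !mule_ge0 ?lee_fin.
under eq_bigr => j _ do rewrite muleCA.
rewrite -ge0_sume_distrr; last by move=> j _; rewrite mule_ge0 ?lee_fin.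
apply: (le_trans (lee_wpmul2l _ (chain_level N k a0 aQ))); first by rewrite lee_fin.
rewrite /level_term !muleA -!EFinM lee_wpmul2r//.
  by rewrite adde_ge0 ?lee_fin// mule_ge0// lee_fin exprn_ge0// invr_ge0.
by rewrite lee_fin le_eqVlt; apply/orP; left; apply/eqP; rewrite !exprSr; ring.
Qed.

End chain_bound.

Lemma avg_limit c (a e : R) : 0 < a -> 0 < e ->
  exists N, `|avg H u c (a / 2 ^+ N) - u c| <= e.
Proof.
(* Local integrability of [u] is part of any weak partial derivative, and an index exists since [d]
   is positive. *)
move=> a0 e0; have lu : locally_integrable_rV u by have [] := uv (Ordinal (ltnW d2)).
have [dl dl0 h] := avg_cvg stepH H1 HM c cu lu e0.
have [n ng] := @ltr_add_invr R 0 (dl / a) (divr_gt0 dl0 a0).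
exists n; apply: h; rewrite divr_gt0 ?exprn_gt0//=.
rewrite add0r ltr_pdivlMr// mulrC in ng; apply: le_trans (ltW ng).
rewrite ler_pM2l// lef_pV2 ?posrE ?exprn_gt0//.
by rewrite -natrX ler_nat ltn_expl.
Qed.

(** The path from [u y] to [u x] goes up the averages at [y] to scale [r], across to [x] at scale
    [2 * r], and down the averages at [x]. These three stretches give the factor 3; the two ends are
    limits, with error [e / 2] each. *)
Lemma two_points x y (r : R) (tau : nat -> R) : 0 < r -> `|y - x| <= r ->
  (forall k, 0 <= tau k) -> (forall k, 0 < tau k \/ mu (E_ k) = 0) ->
  (`|u y - u x|%:E <= (chain_cst *+ 3)%:E *
     ((eps * (2 * r))%:E + \sum_(0 <= k <oo) level_term (cube x (2 * r)) tau k))%E.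
Proof.
move=> r0 yx t0 tE; have r20 : 0 < 2 * r by rewrite mulr_gt0.
pose Q := cube x (2 * r); have mQ : measurable Q by exact: measurable_cube.
have Qoo : (mu Q < +oo)%E.
  by apply: (le_lt_trans (lebesgue_cube_le _ (ltW r20))); rewrite ltry.
set S := ((eps * (2 * r))%:E + _)%E.
have C0 : 0 <= chain_cst.
  apply: mulr_ge0; last exact: exprn_ge0.
  by rewrite !mulr_ge0// exprn_ge0// mulr_ge0.
have xQ : cube x (2 * r) `<=` Q by [].
have yQ : cube y r `<=` Q.
  by apply: cube_sub; [exact: ltW|rewrite mulrDl mul1r lerD2r].
apply/lee_addgt0Pr => e e0; have e20 : 0 < e / 2 by rewrite divr_gt0.
have [N hN] := avg_limit x r20 e20; have [N' hN'] := avg_limit y r0 e20.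
have bx := le_trans (chain_avg x N r20) (chain_bound mQ Qoo t0 tE N r20 xQ).
have bl : (`|avg H u y r - avg H u x (2 * r)|%:E <= chain_cst%:E * S)%E.
  (* The link is a single [osc_term], that is, a chain with [N = 1]. *)
  apply: le_trans (chain_bound mQ Qoo t0 tE 1 r20 xQ).
  by rewrite big_ord_recl big_ord0 adde0 expr0 divr1; exact: link_avg.
have by_ : (`|avg H u y (r / 2 ^+ N') - avg H u y r|%:E <= chain_cst%:E * S)%E.
  apply: le_trans (chain_avg y N' r0) _.
  apply: le_trans (chain_bound mQ Qoo t0 tE N' r0 yQ) _.
  rewrite lee_wpmul2l ?lee_fin// leeD2r// lee_fin ler_wpM2l ?(ltW eps0)//.
  by rewrite ler_peMl ?ler1n// ltW.
have S3 : ((chain_cst *+ 3)%:E * S =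
    chain_cst%:E * S + chain_cst%:E * S + chain_cst%:E * S)%E.
  have -> : (chain_cst *+ 3)%:E = (chain_cst%:E + chain_cst%:E + chain_cst%:E)%E.
    by rewrite -!EFinD !mulrS addr0 addrA.
  by rewrite !ge0_muleDl ?adde_ge0 ?lee_fin.
rewrite S3.
apply: le_trans (leeD (leeD (leeD by_ bl) bx) (lexx e%:E)).
rewrite -!EFinD lee_fin.
move: hN hN'; move: (avg H u y (r / _)) (avg H u y r) (avg H u x (2 * r / _)) (avg H u x (2 * r)) => p q p' q'.
have -> : u y - u x = - (p - u y) + (p - q) + (q - q') - (p' - q') + (p' - u x) by ring.
move: (p - u y) (p - q) (q - q') (p' - q') (p' - u x) => p1 p2 p3 p4 p5 h5 h1.
apply: (le_trans (ler_normD _ _)); apply: (@le_trans _ _ (`|p1| + `|p2| + `|p3| + `|p4| + `|p5|)); last lra.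
rewrite lerD2r; apply: (le_trans (ler_normB _ _)); rewrite lerD2r.
apply: (le_trans (ler_normD _ _)); rewrite lerD2r.
by apply: (le_trans (ler_normD _ _)); rewrite normrN.
Qed.

End two_points.

(** * Covering by cubes *)

Section seq_measure.
Context {disp} {T : measurableType disp} {R : realType} {I : Type}.
Variable mu : {measure set T -> \bar R}.
Implicit Types (s : seq I) (F : I -> set T) (E : set T).

Lemma measure_seq_le s F E : measurable E -> (forall i, measurable (F i)) ->
  pairwise (fun i j => `[< F i `&` F j = set0 >]) s ->
  (\sum_(i <- s) mu (E `&` F i) <= mu E)%E.
Proof.
move=> + mF; elim: s E => [|i s ih] E mE; first by rewrite big_nil.
rewrite pairwise_cons => /andP[is_ ps]; rewrite big_cons (measureDI mu mE (mF i)) addeC.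
rewrite leeD2r//; apply: le_trans (ih _ (measurableD mE (mF i)) ps).
elim: s is_ {ih ps} => [|j s ih]; first by rewrite !big_nil.
rewrite /= => /andP[/asboolP ij /ih {}ih]; rewrite !big_cons leeD//.
rewrite (_ : E `&` F j = (E `\` F i) `&` F j)//.
apply/seteqP; split=> x [Ex Fx]; last by split=> //; case: Ex.
by split=> //; split=> // Fi; have : (F i `&` F j) x by []; rewrite ij.
Qed.

(** The index type carries no decidable equality, so membership in [s] is expressed by a position,
    read with an arbitrary default. *)
Lemma measure_seq_cover s F E : measurable E -> (forall i, measurable (F i)) ->
  (forall x, E x -> exists2 k, (k < size s)%N & forall i0, F (nth i0 s k) x) ->
  (mu E <= \sum_(i <- s) mu (F i))%E.
Proof.
move=> + mF; elim: s E => [|i s ih] E mE cov.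
  rewrite big_nil (_ : E = set0) ?measure0//.
  by apply/seteqP; split=> x // /cov[].
rewrite big_cons (measureDI mu mE (mF i)) addeC leeD//.
  exact: measureIr.
apply: ih; first exact: measurableD.
move=> x [/cov[[|k] ks h] nFi]; last by exists k.
by case: nFi; exact: h i.
Qed.

End seq_measure.

Section vitali.
Variables (R : realType) (d : nat).
Local Notation mu := (lebesgue_rV R d).
Implicit Types (p q : 'rV[R]_d * R) (s : seq ('rV[R]_d * R)).

Definition disjoint_cubes p q := `[< cube p.1 p.2 `&` cube q.1 q.2 = set0 >].

Lemma seq_max_radius p s : exists2 q, q \in p :: s & forall p', p' \in p :: s -> p'.2 <= q.2.
Proof.
elim: s p => [|p1 s ih] p.
  by exists p; rewrite ?mem_head// => p'; rewrite inE => /eqP ->.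
have [q qs qmax] := ih p1; have [pq|qp] := leP p.2 q.2.
  exists q; first by rewrite inE qs orbT.
  by move=> p'; rewrite inE => /orP[/eqP ->//|]; exact: qmax.
exists p; first by rewrite mem_head.
move=> p'; rewrite inE => /orP[/eqP ->//|/qmax p'q].
exact: le_trans p'q (ltW qp).
Qed.

(** Greedy selection: a cube [q] of largest radius is kept, and every cube meeting it, being no
    larger, lies in the tripled [q]; the selection continues among the cubes disjoint from [q]. *)
Lemma vitali_cubes s : (forall p, p \in s -> 0 < p.2) ->
  exists D : seq ('rV[R]_d * R), [/\ {subset D <= s}, pairwise disjoint_cubes D &
    forall p, p \in s -> exists2 q, q \in D & cube p.1 p.2 `<=` cube q.1 (3 * q.2)].
Proof.
move: {2}(size s).+1 (ltnSn (size s)) => n; elim: n s => // n ih [|p s] sn pos.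
  by exists [::].
have [q qs qmax] := seq_max_radius p s.
set s0 := p :: s in sn pos qs qmax *.
have q0 : 0 < q.2 by exact: pos.
(* Since [q] meets itself, filtering removes it and the list gets strictly shorter. *)
have nqq : ~~ disjoint_cubes q q.
  apply/asboolPn => /seteqP[+ _] => /(_ q.1); apply.
  by split=> i; rewrite subrr normr0 ltW.
have [||D [Ds pD Dcov]] := ih [seq p' <- s0 | disjoint_cubes q p'].
- rewrite size_filter -ltnS (leq_trans _ sn)// ltnS.
  rewrite -(count_predC (disjoint_cubes q) s0) -[X in (X < _)%N]addn0 ltn_add2l.
  by rewrite -has_count; apply/hasP; exists q.
- by move=> p'; rewrite mem_filter => /andP[_ /pos].
exists (q :: D); split.
- move=> p'; rewrite inE => /orP[/eqP ->//|/Ds].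
  by rewrite mem_filter => /andP[].
- rewrite pairwise_cons pD andbT; apply/allP => p' /Ds.
  by rewrite mem_filter => /andP[].
- move=> p' p's; have [qp'|/asboolPn/eqP/set0P[z [qz p'z]]] := boolP (disjoint_cubes q p').
    have [|q' q'D h] := Dcov p'; first by rewrite mem_filter qp'.
    by exists q' => //; rewrite inE q'D orbT.
  exists q; first by rewrite mem_head.
  move=> w p'w i; have pq := qmax _ p's.
  have -> : w 0 i - q.1 0 i = (w 0 i - p'.1 0 i) - (z 0 i - p'.1 0 i) + (z 0 i - q.1 0 i) by ring.
  apply: le_trans (ler_normD _ _) _.
  have := ler_normB (w 0 i - p'.1 0 i) (z 0 i - p'.1 0 i).
  by have := p'w i; have := p'z i; have := qz i; lra.
Qed.

Lemma compact_measurable_rV (K : set 'rV[R]_d) : compact K -> measurable K.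
Proof.
move=> cK; have clK : closed K by apply: compact_closed => //; exact: norm_hausdorff.
rewrite -[X in measurable X]setCK; apply: measurableC.
by apply: open_measurable_mx; rewrite openC.
Qed.

Lemma vitali_compact (K : set 'rV[R]_d) (r : 'rV[R]_d -> R) : compact K ->
  (forall x, K x -> 0 < r x) ->
  exists D : seq ('rV[R]_d * R), [/\ forall p, p \in D -> K p.1 /\ p.2 = r p.1,
    pairwise disjoint_cubes D &
    (mu K <= \sum_(p <- D) mu (cube p.1 (3 * p.2)))%E].
Proof.
move=> cK r0.
have [D0 D0K Kcov] : finite_subset_cover K (fun x => ball x (r x)) K.
  move: (cK); rewrite compact_cover; apply.
    by move=> x _; exact: ball_open.
  by move=> x Kx; exists x => //; apply: ballxx; exact: r0.
pose s := [seq (x, r x) | x <- finmap.enum_fset D0].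
have sK p : p \in s -> K p.1 /\ p.2 = r p.1.
  by move=> /mapP[x xD ->] /=; split=> //; have /D0K := xD; rewrite inE.
have [|D [Ds pD Dcov]] := @vitali_cubes s.
  by move=> p /sK[Kp ->]; exact: r0.
exists D; split => //; first by move=> p /Ds /sK.
apply: measure_seq_cover; first exact: compact_measurable_rV.
  by move=> p; exact: measurable_cube.
move=> x /Kcov[y yD xy].
have [|q qD sub] := Dcov (y, r y); first by apply/mapP; exists y.
exists (index q D); first by rewrite index_mem.
move=> i0; rewrite nth_index//; apply: sub => i /=.
have [_ xyi] := xy; apply: ltW; rewrite distrC; exact: xyi.
Qed.

(** [U] is exhausted by the compact sets of points with coordinates bounded by [n] whose ball of
    radius [n.+1%:R^-1] stays in [U]; continuity from below concludes. *)
Lemma open_compact_le (U : set 'rV[R]_d) (B : \bar R) : open U ->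
  (forall K, compact K -> K `<=` U -> (mu K <= B)%E) -> (mu U <= B)%E.
Proof.
move=> oU UB.
pose K n := cube (0 : 'rV[R]_d) n%:R `&` [set z | ball z n.+1%:R^-1 `<=` U].
have KU n : K n `<=` U by move=> z [_]; apply; exact: ballxx.
have cK n : compact (K n).
  apply: (@subclosed_compact _ _ (cube 0 n%:R)) => //; last 2 first.
  - exact: compact_cube.
  - by move=> z [].
  apply: closedI; first exact: closed_cube.
  rewrite -openC (_ : ~` _ = \bigcup_(w in ~` U) ball w n.+1%:R^-1).
    by apply: bigcup_open => w _; exact: ball_open.
  apply/seteqP; split=> [z /existsNP[w /not_implyP[zw Uw]]|z [w Uw wz] zU].
    by exists w => //; exact: ball_sym.
  by apply: Uw; apply: zU; exact: ball_sym.
have ndK : {homo K : n m / (n <= m)%N >-> (n <= m)%O}.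
  move=> n m nm; apply/subsetPset => z [zn zU]; split.
    by move=> i; rewrite (le_trans (zn i))// ler_nat.
  apply: subset_trans zU; apply: le_ball.
  by rewrite lef_pV2 ?posrE// ler_nat.
have UE : U = \bigcup_n K n.
  apply/seteqP; split=> [z Uz|z [n _ /KU]//].
  have /nbhs_ballP[e /= e0 eU] : nbhs z U by exact: open_nbhs_nbhs.
  have [n1 hn1] := @ltr_add_invr R 0 e e0; rewrite add0r in hn1.
  pose n2 := Num.bound `|z|.
  have Kz n : (n1 <= n)%N -> (n2 <= n)%N -> K n z.
    move=> n1n n2n; split.
      apply/cubeP => //; rewrite subr0 (le_trans (ltW (archi_boundP (normr_ge0 z))))//.
      by rewrite ler_nat.
    apply: subset_trans eU; apply: le_ball; apply: le_trans (ltW hn1).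
    by rewrite lef_pV2 ?posrE// ler_nat.
  by exists (maxn n1 n2) => //; apply: Kz; [exact: leq_maxl|exact: leq_maxr].
have mK n := compact_measurable_rV (cK n).
have cv := @nondecreasing_cvg_mu _ _ _ mu K mK (bigcup_measurable (fun n _ => mK n)) ndK.
rewrite {1}UE -(cvg_lim _ cv)//; apply: lime_le; first by apply/cvg_ex; eexists; exact: cv.
by apply: nearW => n; exact: UB.
Qed.

End vitali.

(** * The weak-type estimate for abstract gradients *)

Section weak_type.
Variables (R : realType) (d : nat).
Hypothesis d2 : (2 <= d)%N.
Local Notation mu := (lebesgue_rV R d).
Variable g : 'rV[R]_d -> R.
Hypothesis mg : measurable_fun setT g.
Hypothesis g0 : forall z, 0 <= g z.
Hypothesis goo : (lorentz1_norm mu d%:R g < +oo)%E.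
Variable eps : R.
Hypothesis eps0 : 0 < eps.
Local Notation level := (level eps).
Local Notation E_ := (superlevel eps g).
Local Notation Lg := (lorentz1_norm mu d%:R g).

Let d0 : (0 < d)%N. Proof. exact: ltnW. Qed.

Let powRK (x : R) : 0 <= x -> (x `^ d%:R^-1) ^+ d = x.
Proof.
move=> x0; rewrite -powR_mulrn ?powR_ge0// -powRrM mulVf ?powRr1//.
by rewrite pnatr_eq0 -lt0n.
Qed.

(** If the measure were infinite, [lorentz1_norm_ge] would allow any value of [b k]; taking
    [b k = c ^+ d] makes the single term [level k * c] exceed twice the finite norm. *)
Lemma superlevel_lty k : (mu (E_ k) < +oo)%E.
Proof.
rewrite ltNge leye_eq; apply/negP => /eqP Ek.
have L0 : (0 <= Lg)%E.
  have := lorentz1_norm_ge eps0 mg g0 d0 (b := fun=> 0) (fun=> lexx 0) (fun j => measure_ge0 mu _).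
  rewrite eseries0 ?pmule_rge0// => j _ _.
  by rewrite powR0 ?mulr0// invr_eq0 pnatr_eq0 -lt0n.
have finL : Lg \is a fin_num by rewrite ge0_fin_numE.
pose c := 2 * fine Lg / level k + 1.
have lk := level_gt0 eps0 k.
have c0 : 0 <= c by rewrite addr_ge0// divr_ge0 ?(ltW lk)// mulr_ge0// fine_ge0.
pose b j := if j == k then c ^+ d else 0.
have b0 j : 0 <= b j by rewrite /b; case: ifP => // _; rewrite exprn_ge0.
have bE j : ((b j)%:E <= mu (E_ j))%E.
  by rewrite /b; case: eqP => [->|_]; rewrite ?Ek ?leey.
have t0 j : (0 <= (level j * b j `^ d%:R^-1)%:E)%E.
  by rewrite lee_fin mulr_ge0 ?powR_ge0// ltW// level_gt0.
have := lorentz1_norm_ge eps0 mg g0 d0 b0 bE.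
move=> /(le_trans (nneseries_lim_ge k.+1 (fun j _ _ => t0 j))).
rewrite big_nat_recr//= -(fineK finL) -EFinM => /(le_trans _) h.
have : (level k * b k `^ d%:R^-1 <= 2 * fine Lg).
  by rewrite -lee_fin; apply: h; rewrite leeDr// sume_ge0.
rewrite /b eqxx -powR_mulrn// -powRrM divff ?powRr1 ?pnatr_eq0 -?lt0n//.
by rewrite /c mulrDr mulr1 mulrC divfK ?gt_eqF// gerDl leNgt lk.
Qed.

(** The side of a cube with the measure of the level set; [fine] loses nothing by
    [superlevel_lty]. *)
Definition alpha k : R := fine (mu (E_ k)) `^ d%:R^-1.

Lemma alpha_ge0 k : 0 <= alpha k. Proof. exact: powR_ge0. Qed.

Lemma alphaX k : mu (E_ k) = (alpha k ^+ d)%:E.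
Proof. by rewrite powRK ?fine_ge0// fineK// ge0_fin_numE// superlevel_lty. Qed.

Lemma alpha_gt0_or k : 0 < alpha k \/ mu (E_ k) = 0%E.
Proof.
have := alpha_ge0 k; rewrite le_eqVlt => /orP[/eqP a0|]; last by left.
by right; rewrite alphaX -a0 expr0n -(prednK d0).
Qed.

Definition level_sum : \bar R := (\sum_(0 <= k <oo) (level k * alpha k)%:E)%E.

Lemma level_sum_le : (level_sum <= 2%:E * Lg)%E.
Proof.
apply: (lorentz1_norm_ge eps0 mg g0 d0 (b := fun k => fine (mu (E_ k)))).
  by move=> k; exact: fine_ge0.
by move=> k; rewrite fineK// ge0_fin_numE// superlevel_lty.
Qed.

Let term0 k : (0 <= (level k * alpha k)%:E)%E.
Proof. by rewrite lee_fin mulr_ge0 ?alpha_ge0// ltW// level_gt0. Qed.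

Lemma level_sum_ge0 : (0 <= level_sum)%E.
Proof. exact: nneseries_ge0. Qed.

(* The integral of [F] over [Q]; since [0^-1 = 0], the levels with
   [alpha k = 0] do not contribute. *)
Definition weight (Q : set 'rV[R]_d) : \bar R :=
  (\sum_(0 <= k <oo) (level k * (alpha k)^-1 ^+ d.-1)%:E * mu (E_ k `&` Q))%E.

Let coef_ge0 k : 0 <= level k * (alpha k)^-1 ^+ d.-1.
Proof. by rewrite mulr_ge0 ?exprn_ge0 ?invr_ge0 ?alpha_ge0// ltW// level_gt0. Qed.

Lemma weight_ge0 Q : (0 <= weight Q)%E.
Proof. by apply: nneseries_ge0 => k _ _; rewrite mule_ge0// lee_fin. Qed.

(** At each level, disjointness bounds the total measure by [alpha k ^+ d], which turns the
    coefficient [(alpha k)^-1 ^+ d.-1] into [alpha k]. *)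
Lemma sum_weight_le (I : Type) (s : seq I) (F : I -> set 'rV[R]_d) :
  (forall i, measurable (F i)) -> pairwise (fun i j => `[< F i `&` F j = set0 >]) s ->
  (\sum_(i <- s) weight (F i) <= level_sum)%E.
Proof.
move=> mF ps; rewrite /weight -nneseries_sum; last first.
  by move=> i k _; rewrite mule_ge0// lee_fin.
apply: lee_nneseries => [k _ _|k _].
  by apply: sume_ge0 => i _; rewrite mule_ge0// lee_fin.
rewrite -ge0_sume_distrr//.
have mE := measurable_superlevel eps mg k.
have h : (\sum_(i <- s) mu (E_ k `&` F i) <= mu (E_ k))%E by exact: measure_seq_le.
apply: (le_trans (lee_wpmul2l _ h)); first by rewrite lee_fin.
rewrite alphaX -EFinM lee_fin -mulrA ler_wpM2l ?(ltW (level_gt0 eps0 k))//.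
have := alpha_ge0 k; rewrite le_eqVlt => /orP[/eqP <-|a0].
  by rewrite expr0n -(prednK d0) mulr0.
rewrite -{2}(prednK d0) exprS mulrCA exprVn mulVf ?mulr1//.
by rewrite expf_neq0// gt_eqF.
Qed.

Lemma sum_level_term (Q : set 'rV[R]_d) (dl : R) : 0 < dl ->
  (\sum_(0 <= k <oo) level_term g eps Q (fun k => (dl * alpha k)%R) k =
   dl%:E * level_sum + (dl^-1 ^+ d.-1)%:E * weight Q)%E.
Proof.
move=> dl0; rewrite -nneseriesZl// -nneseriesZl; last first.
  by move=> k _; rewrite mule_ge0// lee_fin.
have D0 : 0 <= dl^-1 ^+ d.-1 by rewrite exprn_ge0// invr_ge0 ltW.
rewrite -nneseriesD; last 2 first.
- by move=> k _ _; rewrite mule_ge0// lee_fin ltW.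
- by move=> k _ _; rewrite !mule_ge0// lee_fin.
apply: eq_eseriesr => k _; rewrite /level_term.
have l0 := ltW (level_gt0 eps0 k); have a0 := alpha_ge0 k.
have da0 : 0 <= dl * alpha k by rewrite mulr_ge0// ltW.
rewrite ge0_muleDr ?lee_fin//; last first.
  by rewrite mule_ge0// lee_fin exprn_ge0// invr_ge0.
congr (_ + _)%E; first by rewrite -!EFinM mulrCA.
by rewrite !muleA -!EFinM invfM exprMn; congr (_%:E * _)%E; ring.
Qed.

(** The choices of [eps] and [dl] make the [eps] term and the level sum cost at most
    [lambda * r / 4] each. The weight must carry the remaining half, and multiplication by
    [2 * (lambda * r) ^+ d.-1] removes [dl], because [lambda * r / dl = 4 * K * S]. *)
Lemma weight_lower_bound (Q : set 'rV[R]_d) (K S lambda r : R) :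
  0 < K -> 0 < S -> (level_sum <= S%:E)%E -> 0 < lambda -> 0 < r ->
  eps = lambda / (8 * K) ->
  (forall tau : nat -> R, (forall k, 0 <= tau k) ->
    (forall k, 0 < tau k \/ mu (E_ k) = 0%E) ->
    ((lambda * r)%:E <= K%:E *
      ((eps * (2 * r))%:E + \sum_(0 <= k <oo) level_term g eps Q tau k))%E) ->
  (((lambda * r) ^+ d)%:E <= (2 * K * (4 * K * S) ^+ d.-1)%:E * weight Q)%E.
Proof.
move=> K0 S0 levS l0 r0 epsE hyp.
have lr0 : 0 < lambda * r by rewrite mulr_gt0.
pose dl := lambda * r / (4 * K * S).
have dl0 : 0 < dl by rewrite divr_gt0// !mulr_gt0.
have Dl0 : 0 <= dl^-1 ^+ d.-1 by rewrite exprn_ge0// invr_ge0 ltW.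
have := hyp (fun k => dl * alpha k).
move=> /(_ (fun k => mulr_ge0 (ltW dl0) (alpha_ge0 k))).
have tE k : 0 < dl * alpha k \/ mu (E_ k) = 0%E.
  by have [a0|->] := alpha_gt0_or k; [left; rewrite mulr_gt0|right].
move=> /(_ tE); rewrite sum_level_term// => h.
pose X := ((dl^-1 ^+ d.-1)%:E * weight Q)%E.
have X0 : (0 <= X)%E by rewrite mule_ge0 ?lee_fin ?weight_ge0.
have {}h : ((lambda * r)%:E <= (lambda * r / 2)%:E + K%:E * X)%E.
  apply: (le_trans h); rewrite ge0_muleDr ?lee_fin; last 2 first.
  - by rewrite !mulr_ge0// ltW.
  - by rewrite adde_ge0// mule_ge0 ?level_sum_ge0// lee_fin ltW.
  rewrite ge0_muleDr; [|by rewrite mule_ge0 ?level_sum_ge0// lee_fin ltW|by []].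
  rewrite addeA leeD2r//.
  apply: (@le_trans _ _ (K%:E * (eps * (2 * r))%:E + K%:E * (dl%:E * S%:E))%E).
    by rewrite leeD2l// !lee_wpmul2l// lee_fin ltW.
  rewrite -!EFinM -EFinD lee_fin epsE le_eqVlt; apply/orP; left; apply/eqP.
  by rewrite /dl; field; rewrite !gt_eqF.
have {h}h : ((lambda * r / 2)%:E <= K%:E * X)%E.
  rewrite -[(K%:E * X)%E](adde0) -[leLHS](_ : (lambda * r)%:E - (lambda * r / 2)%:E = _)%E.
    by rewrite adde0 leeBlDl.
  by rewrite -EFinB; congr EFin; lra.
have E : lambda * r * dl^-1 = 4 * K * S.
  by rewrite /dl invf_div mulrC divfK// gt_eqF.
have dE : d = d.-1.+1 by rewrite prednK.
have -> : ((lambda * r) ^+ d)%:E = ((2 * (lambda * r) ^+ d.-1)%:E * (lambda * r / 2)%:E)%E.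
  rewrite -EFinM {1}dE exprS; congr EFin.
  by rewrite [LHS]mulrC; field.
apply: (le_trans (lee_wpmul2l _ h)); first by rewrite lee_fin mulr_ge0// exprn_ge0// ltW.
rewrite /X !muleA -!EFinM -E !exprMn le_eqVlt; apply/orP; left; apply/eqP.
by congr (_%:E * _)%E; ring.
Qed.

(** On a compact part of [U], Vitali selects disjoint cubes of radius [2 * r]; their triples have
    side [12 * r], whence [12 ^+ d], and the weights of disjoint cubes sum to at most
    [level_sum]. *)
Lemma weak_type_cover (U : set 'rV[R]_d) (lambda C : R) : open U -> 0 < lambda -> 0 <= C ->
  (forall x, U x -> exists2 r, 0 < r &
    (((lambda * r) ^+ d)%:E <= C%:E * weight (cube x (2 * r)))%E) ->
  ((lambda ^+ d)%:E * mu U <= (12 ^+ d * C)%:E * level_sum)%E.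
Proof.
move=> oU l0 C0 hU.
have ld0 : 0 < lambda ^+ d by rewrite exprn_gt0.
rewrite -lee_pdivlMl//; apply: open_compact_le => // K cK KU.
rewrite lee_pdivlMl//.
have /choice[r hr] x : exists r : R, U x ->
    0 < r /\ (((lambda * r) ^+ d)%:E <= C%:E * weight (cube x (2 * r)))%E.
  have [/hU[r r0 h]|nU] := pselect (U x); first by exists r.
  by exists 0.
have r20 x : K x -> 0 < 2 * r x.
  by move=> /KU/hr[r0 _]; rewrite mulr_gt0.
have [D [DK pD KD]] := vitali_compact cK r20.
apply: (le_trans (lee_wpmul2l _ KD)); first by rewrite lee_fin ltW.
rewrite ge0_sume_distrr//.
apply: (@le_trans _ _ (\sum_(p <- D) (12 ^+ d * C)%:E * weight (cube p.1 p.2))%E).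
  rewrite [leLHS]big_seq [leRHS]big_seq; apply: lee_sum => p /DK[/KU Up pr].
  have [r0 h] := hr _ Up; rewrite pr.
  have r60 : 0 <= 3 * (2 * r p.1) by rewrite !mulr_ge0// ltW.
  apply: (le_trans (lee_wpmul2l _ (lebesgue_cube_le p.1 r60))); first by rewrite lee_fin ltW.
  have -> : ((lambda ^+ d)%:E * ((3 * (2 * r p.1) *+ 2) ^+ d)%:E =
      (12 ^+ d)%:E * ((lambda * r p.1) ^+ d)%:E)%E.
    by rewrite -!EFinM -!exprMn; congr (_ ^+ _)%:E; rewrite mulr2n; ring.
  by rewrite EFinM -muleA lee_wpmul2l// lee_fin exprn_ge0.
rewrite -ge0_sume_distrr; last by move=> p _; exact: weight_ge0.
rewrite lee_wpmul2l ?lee_fin ?mulr_ge0 ?exprn_ge0//.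
by apply: sum_weight_le => // p; exact: measurable_cube.
Qed.

End weak_type.

(** * Complex-valued functions *)

Section complex_functions.
Variables (R : realType) (d : nat).
Local Notation mu := (lebesgue_rV R d).
Local Notation normc := ComplexField.Normc.normc.
Local Notation Re := (@complex.Re R).
Local Notation Im := (@complex.Im R).

Lemma normcE (z : R[i]) : normc z = Num.sqrt (Re z ^+ 2 + Im z ^+ 2).
Proof. by case: z. Qed.

Lemma Re_le_normc (z : R[i]) : `|Re z| <= normc z.
Proof. by rewrite normcE -sqrtr_sqr ler_wsqrtr// lerDl sqr_ge0. Qed.

Lemma Im_le_normc (z : R[i]) : `|Im z| <= normc z.
Proof. by rewrite normcE -sqrtr_sqr ler_wsqrtr// lerDr sqr_ge0. Qed.

Lemma normc_le_ReIm (z : R[i]) : normc z <= `|Re z| + `|Im z|.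
Proof.
rewrite normcE -[leRHS]ger0_norm ?addr_ge0// -sqrtr_sqr ler_wsqrtr//.
rewrite sqrrD !real_normK ?num_real// lerD2r lerDl mulrn_wge0// mulr_ge0//.
Qed.

Lemma normc_ge0 (z : R[i]) : 0 <= normc z.
Proof. by rewrite normcE sqrtr_ge0. Qed.

Lemma le_grad_norm (G : 'I_d -> 'rV[R]_d -> R[i]) i z : normc (G i z) <= grad_norm G z.
Proof.
rewrite /grad_norm -[leLHS]ger0_norm ?normc_ge0// -sqrtr_sqr ler_wsqrtr//.
by rewrite (bigD1 i)//= lerDl sumr_ge0// => j _; rewrite sqr_ge0.
Qed.

Lemma measurable_grad_norm (G : 'I_d -> 'rV[R]_d -> R[i]) :
  (forall i, measurable_fun setT (Re \o G i)) ->
  (forall i, measurable_fun setT (Im \o G i)) ->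
  measurable_fun setT (grad_norm G).
Proof.
move=> mRe mIm; rewrite /grad_norm.
apply: (@measurableT_comp _ _ _ _ _ _ (@Num.sqrt R)).
  by apply: continuous_measurable_fun; exact: sqrt_continuous.
apply: measurable_sum => i.
rewrite (_ : (fun z => _) = (fun z => Re (G i z) ^+ 2 + Im (G i z) ^+ 2)); last first.
  by apply/funext => z; rewrite normcE sqr_sqrtr// addr_ge0// sqr_ge0.
apply: measurable_funD; apply: measurable_funX; [exact: mRe|exact: mIm].
Qed.

Lemma continuous_normcB (A : 'rV[R]_d -> R[i]) (x : 'rV[R]_d) :
  continuous (A : 'rV[R]_d -> R[i]^o) ->
  forall e, 0 < e -> \forall y \near x, normc (A x - A y) < e.
Proof.
move=> cA e e0; have /cvgrPdist_lt := cA x.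
have eC : (0 : R[i]) < e%:C%C by rewrite ltcR.
move=> /(_ _ eC); apply: filterS => y.
by rewrite normc_def ltcR normcE.
Qed.

Lemma continuous_Re (A : 'rV[R]_d -> R[i]) :
  continuous (A : 'rV[R]_d -> R[i]^o) -> continuous (Re \o A).
Proof.
move=> cA x; apply/(@cvgrPdist_lt _ _ _ (nbhs x)) => e e0.
near=> y; apply: (@le_lt_trans _ _ (normc (A x - A y))).
  by rewrite /= -raddfB Re_le_normc.
by near: y; exact: continuous_normcB.
Unshelve. all: by end_near. Qed.

Lemma continuous_Im (A : 'rV[R]_d -> R[i]) :
  continuous (A : 'rV[R]_d -> R[i]^o) -> continuous (Im \o A).
Proof.
move=> cA x; apply/(@cvgrPdist_lt _ _ _ (nbhs x)) => e e0.
near=> y; apply: (@le_lt_trans _ _ (normc (A x - A y))).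
  by rewrite /= -raddfB Im_le_normc.
by near: y; exact: continuous_normcB.
Unshelve. all: by end_near. Qed.

Lemma norm_le_eucl_norm (h : 'rV[R]_d) : `|h| <= eucl_norm h.
Proof.
rewrite [leLHS]/Num.norm/= mx_normrE; apply/bigmax_leP; split=> [|[i j] _ /=].
  exact: sqrtr_ge0.
rewrite (ord1 i) -sqrtr_sqr ler_wsqrtr// (bigD1 j)//= lerDl sumr_ge0// => k _.
exact: sqr_ge0.
Qed.

Lemma max_diff_quotient_gt (A : 'rV[R]_d -> R[i]) (x : 'rV[R]_d) (lambda : R) :
  (lambda%:E < max_diff_quotient A x)%E <->
  exists2 h, h != 0 & lambda * eucl_norm h < normc (A (x + h) - A x).
Proof.
have eh (h : 'rV[R]_d) : h != 0 -> 0 < eucl_norm h.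
  move=> h0; apply: (@lt_le_trans _ _ `|h|); first by rewrite normr_gt0.
  exact: norm_le_eucl_norm.
split => [/ereal_sup_gt[_ [h /= h0 <-]]|[h h0 lh]].
  by rewrite lte_fin ltr_pdivlMr ?eh// => ?; exists h.
apply: (@lt_le_trans _ _ (normc (A (x + h) - A x) / eucl_norm h)%:E).
  by rewrite lte_fin ltr_pdivlMr ?eh.
by apply: ereal_sup_ubound; exists h.
Qed.

(** For fixed [h] the strict inequality persists near [x] by continuity of [A] at [x] and at
    [x + h]. Openness is what permits the exhaustion by compact sets. *)
Lemma open_max_diff_quotient_gt (A : 'rV[R]_d -> R[i]) (lambda : R) :
  continuous (A : 'rV[R]_d -> R[i]^o) ->
  open [set x | (lambda%:E < max_diff_quotient A x)%E].
Proof.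
move=> cA; rewrite openE => x /= /max_diff_quotient_gt[h h0 lh].
pose e := (normc (A (x + h) - A x) - lambda * eucl_norm h) / 2.
have e0 : 0 < e by rewrite divr_gt0// subr_gt0.
have c1 := continuous_normcB x cA e0.
have c2 : \forall y \near x, normc (A (x + h) - A (y + h)) < e.
  have s : (y + h) @[y --> x] --> x + h.
    by apply: (@cvgD R 'rV[R]_d _ (nbhs x) _ id (cst h)) => //; exact: cvg_cst.
  exact: (s _ (continuous_normcB (x + h) cA e0)).
rewrite /interior; near=> y; apply/max_diff_quotient_gt; exists h => //.
have n1 : normc (A x - A y) < e by near: y.
have n2 : normc (A (x + h) - A (y + h)) < e by near: y.
have : normc (A (x + h) - A x) <= normc (A (x + h) - A (y + h)) +
    (normc (A (y + h) - A y) + normc (A x - A y)).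
  have -> : A (x + h) - A x =
      (A (x + h) - A (y + h)) + ((A (y + h) - A y) + - (A x - A y)) by ring.
  apply: (le_trans (le_normcD _ _)); rewrite lerD2l.
  by apply: (le_trans (le_normcD _ _)); rewrite normcN.
by rewrite /e in n1 n2; lra.
Unshelve. all: by end_near. Qed.

End complex_functions.

(** * The weak-type inequality for the maximal difference quotient *)

Theorem lemma2p2 (R : realType) (d : nat) (hd : (2 <= d)%N) :
  exists C : R, forall (A : 'rV[R]_d -> R[i]) (G : 'I_d -> 'rV[R]_d -> R[i]),
    continuous (A : 'rV[R]_d -> R[i]^o) ->
    is_weak_gradient A G ->
    (lorentz1_norm (lebesgue_rV R d) d%:R (grad_norm G) < +oo)%E ->
    forall lambda : R, 0 < lambda ->
      ((lambda ^+ d)%:E *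
         lebesgue_rV R d [set x | (lambda%:E < max_diff_quotient A x)%E]
       <= C%:E * lorentz1_norm (lebesgue_rV R d) d%:R (grad_norm G) ^+ d)%E.
Proof.
have [H [M M1 [stepH H1 HM]]] := smooth_step_bounded R.
have M0 : 0 <= M by apply: le_trans M1.
have d0 : (0 < d)%N by exact: ltnW.
(* Three times the chain constant for each of the real and imaginary parts; adding 1 makes [K]
   positive. *)
pose K : R := chain_cst d M *+ 6 + 1.
have C0 : 0 <= chain_cst d M.
  apply: mulr_ge0; last exact: exprn_ge0.
  by rewrite !mulr_ge0// exprn_ge0// mulr_ge0.
have K0 : 0 < K by rewrite ltr_wpDl// mulrn_wge0.
(* The factors come from the covering, from [weight_lower_bound], and from the bound of the level
   sum by twice the norm, raised to the power [d]. *)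
exists (12 ^+ d * (2 * K * (4 * K) ^+ d.-1) * 2 ^+ d) => A G cA wG goo lambda l0.
set g := grad_norm G in goo *; set mu := lebesgue_rV R d in goo *.
set L := lorentz1_norm mu d%:R g in goo *.
have mg : measurable_fun setT g.
  by apply: measurable_grad_norm => i; have [[_ [? _] _] [_ [? _] _]] := wG i.
have g0 z : 0 <= g z by exact: sqrtr_ge0.
pose eps := lambda / (8 * K).
have eps0 : 0 < eps by rewrite divr_gt0// mulr_gt0.
set U := [set x | _].
have oU : open U by exact: open_max_diff_quotient_gt.
have levS := level_sum_le hd mg g0 goo eps0.
have lev0 := level_sum_ge0 g eps0.
rewrite -/L in levS.
have L0 : (0 <= L)%E by rewrite -(@pmule_rge0 _ 2%:E)// (le_trans lev0).
have finL : L \is a fin_num by rewrite ge0_fin_numE.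
have levoo : (level_sum g eps < +oo)%E.
  by apply: (le_lt_trans levS); rewrite -(fineK finL) -EFinM ltry.
have levfin : level_sum g eps \is a fin_num by rewrite ge0_fin_numE.
(* Any positive bound of the level sum is allowed here, so that the degenerate
   case of a zero level sum needs no separate estimate. *)
have bound S : 0 < S -> (level_sum g eps <= S%:E)%E ->
    ((lambda ^+ d)%:E * mu U <=
     (12 ^+ d * (2 * K * (4 * K * S) ^+ d.-1))%:E * level_sum g eps)%E.
  move=> S0 SS; apply: weak_type_cover => //.
    by rewrite !mulr_ge0 ?exprn_ge0 ?mulr_ge0 ?ltW.
  move=> x /max_diff_quotient_gt[h h0 lh].
  (* The radius is the sup norm of [h], as suits cubes; it is at most the Euclidean norm, so the
     lower bound on the increment survives. *)
  have r0 : 0 < `|h| by rewrite normr_gt0.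
  exists `|h| => //; apply: weight_lower_bound => // tau t0 tE.
  have hx : `|x + h - x| <= `|h| by rewrite addrAC subrr add0r.
  have bRe := two_points hd stepH H1 HM M0 (continuous_Re cA) (fun i => (wG i).1) mg g0
    (fun i z => le_trans (Re_le_normc _) (le_grad_norm G i z)) eps0 r0 hx t0 tE.
  have bIm := two_points hd stepH H1 HM M0 (continuous_Im cA) (fun i => (wG i).2) mg g0
    (fun i z => le_trans (Im_le_normc _) (le_grad_norm G i z)) eps0 r0 hx t0 tE.
  have T0 : (0 <= (eps * (2 * `|h|))%:E +
      \sum_(0 <= k <oo) level_term g eps (cube x (2 * `|h|)) tau k)%E.
    apply: adde_ge0; first by rewrite lee_fin mulr_ge0 ?(ltW eps0)// mulr_ge0.
    by apply: nneseries_ge0 => k _ _; exact: level_term_ge0.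
  have := leeD bRe bIm; rewrite -ge0_muleDl ?lee_fin ?mulrn_wge0// -!EFinD -mulrnDr => bnd.
  apply: (@le_trans _ _ ((chain_cst d M *+ 6)%:E * ((eps * (2 * `|h|))%:E +
      \sum_(0 <= k <oo) level_term g eps (cube x (2 * `|h|)) tau k))%E); last first.
    by rewrite lee_wpmul2r// lee_fin lerDl.
  apply: le_trans bnd; rewrite lee_fin.
  apply: (@le_trans _ _ (ComplexField.Normc.normc (A (x + h) - A x))).
    apply: ltW; apply: le_lt_trans lh; rewrite ler_wpM2l ?(ltW l0)//.
    exact: norm_le_eucl_norm.
  apply: (le_trans (normc_le_ReIm _)).
  by rewrite /= !raddfB.
(* With a zero level sum, [S = 1] is admissible and the bound reads 0. *)
have [lev_eq0|lev_neq0] := eqVneq (level_sum g eps) 0%E.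
  have := bound 1 ltr01; rewrite lev_eq0 mule0 lee_fin => /(_ ler01)/le_trans; apply.
  rewrite mule_ge0 ?expe_ge0// lee_fin.
  by rewrite !mulr_ge0 ?exprn_ge0 ?mulr_ge0 ?ltW.
pose S := fine (level_sum g eps).
have S0 : 0 < S by rewrite fine_gt0// lt0e lev_neq0 lev0.
have := bound S S0; rewrite fineK// => /(_ (lexx _))/le_trans; apply.
rewrite -(fineK levfin) -/S -EFinM.
have SL : S <= 2 * fine L by rewrite -lee_fin EFinM fineK// fineK.
have fL0 : 0 <= fine L by exact: fine_ge0.
rewrite -(fineK finL) -EFin_expe -EFinM lee_fin.
(* The power [S ^+ d.-1] of the lower bound and the factor [S] of the covering combine into the
   exponent [d] of the norm. *)
have -> : 12 ^+ d * (2 * K * (4 * K * S) ^+ d.-1) * S =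
    12 ^+ d * (2 * K * (4 * K) ^+ d.-1) * S ^+ d.
  have -> : S ^+ d = S * S ^+ d.-1 by rewrite -exprS prednK.
  by rewrite (exprMn _ _ S); ring.
rewrite -[leRHS]mulrA -exprMn ler_wpM2l//.
  by rewrite !mulr_ge0 ?exprn_ge0 ?mulr_ge0 ?ltW.
by rewrite lerXn2r ?nnegrE ?mulr_ge0// ltW.
Qed.
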